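(* Let $D_1=\{(a,b): a,b>0,\ ab\le 1/4\}$, $D_2=\{(a,b): a,b>0,\ 1/a+1/b\le 4\}$ and $D_3=\{(a,b): a,b>0,\ a+b\le 1\}$. For $a,b>0$ write $F(x)=F(a,b;a+b;x)$, $B=B(a,b)$ and $R=R(a,b)$. (i) For $(a,b)\in D_1$ with $(a,b)\ne(1/2,1/2)$ and each $x\in(0,1)$, $$\frac12<\frac{F\bigl((\frac{1-x}{1+x})^2\bigr)}{(1+x)F(1-x^2)}<\frac{B(a,b)}{2\pi}.$$ (ii) For $(a,b)\in D_3$ and each $x\in(0,1)$, $$(1+x)F(1-x^2)\le 2F\Bigl(\bigl(\tfrac{1-x}{1+x}\bigr)^2\Bigr)\le (1+x)\bigl[F(1-x^2)+(R-\log 16)/B\bigr].$$ (iii) For $(a,b)\in D_2$ with $(a,b)\ne(1/2,1/2)$ and each $x\in(0,1)$, $$\frac{B(a,b)}{2\pi}<\frac{F\bigl((\frac{1-x}{1+x})^2\bigr)}{(1+x)F(1-x^2)}<\frac12,$$ and for $(a,b)\in D_2$ and each $x\in(0,1)$, $$0\le (1+x)F(1-x^2)-2F\Bigl(\bigl(\tfrac{1-x}{1+x}\bigr)^2\Bigr)\le (1+x)(\log 16-R)/B.$$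
   Context: For real $a,b,c$ with $c\ne 0,-1,-2,\dots$, the Gaussian hypergeometric function is $F(a,b;c;x)=\sum_{n=0}^\infty \frac{(a,n)(b,n)}{(c,n)}\frac{x^n}{n!}$ for $x\in(-1,1)$, where $(a,n)=a(a+1)\cdots(a+n-1)$ for $n\ge 1$ and $(a,0)=1$. $B(a,b)=\Gamma(a)\Gamma(b)/\Gamma(a+b)$ is the classical beta function. $R(a,b)=-\Psi(a)-\Psi(b)-2\gamma$, where $\Psi(z)=\Gamma'(z)/\Gamma(z)$ and $\gamma$ is the Euler–Mascheroni constant. Here $a,b$ are real numbers. *)

(* Defs.v *)
From Stdlib Require Import Reals Factorial.
From Coquelicot Require Import Coquelicot.
Open Scope R_scope.

(** Shifted factorial [(a,n) = a (a+1) ... (a+n-1)], with [(a,0) = 1]. *)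
Fixpoint shifted_fact (a : R) (n : nat) : R :=
  match n with
  | O => 1
  | S m => shifted_fact a m * (a + INR m)
  end.

(** [Series] is total; the sum is meaningful for [-1 < x < 1] and
    [c] not in [{0, -1, -2, ...}]. *)
Definition hypergeom (a b c x : R) : R :=
  Series (fun n : nat =>
    shifted_fact a n * shifted_fact b n / shifted_fact c n
    * (x ^ n / INR (fact n))).

(** Euler's integral of [t^(z-1) exp(-t)] over [(0, +oo)], improper at both
    ends; it converges for [z > 0], the only arguments used here. *)
Definition Gamma (z : R) : R :=
  RInt_gen (fun t : R => Rpower t (z - 1) * exp (- t))
    (at_right 0) (Rbar_locally p_infty).

Definition Beta (a b : R) : R := Gamma a * Gamma b / Gamma (a + b).

Definition Psi (z : R) : R := Derive Gamma z / Gamma z.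

(** [gamma = lim_n (1 + 1/2 + ... + 1/(n+1) - ln (n+1))]. *)
Definition euler_gamma : R :=
  real (Lim_seq (fun n : nat =>
    sum_n (fun k : nat => / INR (S k)) n - ln (INR (S n)))).

Definition Rfun (a b : R) : R := - Psi a - Psi b - 2 * euler_gamma.

Definition D1 (a b : R) : Prop := 0 < a /\ 0 < b /\ a * b <= 1 / 4.
Definition D2 (a b : R) : Prop := 0 < a /\ 0 < b /\ 1 / a + 1 / b <= 4.
Definition D3 (a b : R) : Prop := 0 < a /\ 0 < b /\ a + b <= 1.

(* Main.v *)
Require Import Defs.
From Stdlib Require Import Reals Factorial Arith Lra Lia Psatz.
From Coquelicot Require Import Coquelicot.
Open Scope R_scope.

(** Put [r = (1 - x) / (1 + x)] and [s = 4 r / (1 + r)^2].  Then [s = 1 - x^2]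
    and [(1 + x) (1 + r) = 2], so every claim compares [(1 + r) F(r^2)] with
    [F(s)].  Write [G] for [F] at [a = b = 1/2], which is [2/PI] times the
    complete elliptic integral.  For it the comparison is Landen's identity
    [G(s) = (1 + r) G(r^2)] (lemma [landen]); it holds because both sides solve
    the same second order equation in [r] and are regular at [0], so that their
    Wronskian vanishes.

    For general [a, b] the Taylor coefficients of [F] are compared with those of
    [G].  Normalised by the beta function they are
    [T_n(a,b) = Gamma(a+n) Gamma(b+n) / (Gamma(a+b+n) n!)] ([gamma_term]), and
    [T_n(a,b) / T_n(1/2,1/2)] is monotone in [n]: the sign of its increments is
    that of [(a b - 1/4) n + (a b - (a+b)/4)], which is constant on [D1] and on
    [D2] ([gamma_term_cross]).  Since [n T_n -> 1], the ratio tends to [1].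
    On [D1] it decreases, and three facts follow: [F/G] is decreasing
    ([PSeries_ratio_lt]), which with [r^2 < s] and Landen's identity gives
    [F(s) < (1 + r) F(r^2)]; moreover [F <= G] and [B F > PI G], which give
    [PI (1 + r) F(r^2) < B F(s)].  On [D2] all of this is reversed.

    For the additive bounds let [Delta = B F - PI G], whose coefficients
    [T_n(a,b) - T_n(1/2,1/2)] are nonnegative on [D1].  Landen's identity cancels
    the part of [G], so that [B ((1 + r) F(r^2) - F(s))] equals
    [(1 + r) Delta(r^2) - Delta(s)].  As [Delta] is increasing, this is at most
    [r Delta(r^2)], hence at most [Delta(1)], the sum of the coefficients.
    That sum is [R(a,b) - ln 16] ([is_series_gamma_term_sub_half]).  It is
    computed from the telescoping identity
    [sum_(n <= N) (T_n(a,b) - T_n(a+1,b)) = (N+1) T_(N+1)(a,b) / a -> 1/a]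
    and the monotonicity of [T_n] in [a], which together determine the dependence
    on [a] as that of [- Psi], in the manner of Bohr and Mollerup.

    The facts on [Gamma] come from its integral: positivity, the functional
    equation, and log-convexity.  The last two already make [ln Gamma]
    differentiable and squeeze [Psi x] between [ln (x - 1)] and [ln x]
    ([is_derive_lnGamma], [Psi_bounds]); this yields [Psi 1], [Psi (1/2)] and all
    the asymptotics.  [Gamma(1/2)^2 = PI] comes from Wallis' product. *)

(** * The gamma integral *)

Lemma exp_le_compat (u v : R) (Huv : u <= v) : exp u <= exp v.
Proof.
  destruct (Rle_lt_or_eq_dec u v Huv) as [H | ->]; [ left; now apply exp_increasing | lra ].
Qed.

(** For a nonnegative integrand the integrals over compact subintervals increase
    with the interval, so boundedness gives convergence, and the value is their
    supremum.  The last two conclusions let later estimates on the improper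
    integral be proved on compact intervals only. *)
Lemma is_RInt_gen_nonneg_bounded (f : R -> R) (M : R)
  (Cf : forall t, 0 < t -> continuous f t)
  (Pf : forall t, 0 < t -> 0 <= f t)
  (Bf : forall u v, 0 < u -> u < v -> RInt f u v <= M) :
  exists I, is_RInt_gen f (at_right 0) (Rbar_locally p_infty) I /\
    (forall u v, 0 < u -> u < v -> RInt f u v <= I) /\
    (forall K, (forall u v, 0 < u -> u < v -> RInt f u v <= K) -> I <= K).
Proof.
  assert (ex : forall u v, 0 < u -> 0 < v -> ex_RInt f u v).
  { intros u v Hu Hv; apply (ex_RInt_continuous f); intros z [Hz _].
    apply Cf; revert Hz; apply Rmin_case; lra. }
  set (E := fun y => exists u v, 0 < u /\ u < v /\ y = RInt f u v).
  destruct (completeness E) as [I [ub lub]].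
  { exists M; intros y (u & v & Hu & Hv & ->); now apply Bf. }
  { exists (RInt f 1 2), 1, 2; repeat split; lra. }
  assert (le_I : forall u v, 0 < u -> u < v -> RInt f u v <= I)
    by (intros u v Hu Hv; apply ub; now exists u, v).
  exists I; repeat split; [ | exact le_I | ].
  2:{ intros K HK; apply lub; intros y (u & v & Hu & Hv & ->); now apply HK. }
  intros P [eps HP].
  assert (exists u0 v0, 0 < u0 /\ u0 < v0 /\ I - eps < RInt f u0 v0)
    as (u0 & v0 & Hu0 & Hv0 & Hap).
  { apply Classical_Prop.NNPP; intros Hn.
    assert (I <= I - eps); [ | destruct eps; simpl in *; lra ].
    apply lub; intros y (u & v & Hu & Hv & ->).
    apply Rnot_lt_le; intros Hlt; apply Hn; now exists u, v. }
  apply (Filter_prod _ _ _ (fun u => 0 < u < u0) (fun v => v0 < v)).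
  - exists (mkposreal u0 Hu0); intros y Hy H0y.
    change (Rabs (y - 0) < u0) in Hy; rewrite Rminus_0_r, Rabs_pos_eq in Hy; lra.
  - now exists v0.
  - intros u v [Hu Hu'] Hv; exists (RInt f u v); split.
    + apply (RInt_correct f); apply ex; lra.
    + apply HP; change (Rabs (RInt f u v - I) < eps).
      assert (RInt f u v = RInt f u u0 + RInt f u0 v0 + RInt f v0 v) as E1.
      { rewrite <- (RInt_Chasles f u v0 v) by (apply ex; lra).
        rewrite <- (RInt_Chasles f u u0 v0) by (apply ex; lra).
        reflexivity. }
      assert (0 <= RInt f u u0)
        by (apply RInt_ge_0; [lra | apply ex; lra | intros; apply Pf; lra]).
      assert (0 <= RInt f v0 v)
        by (apply RInt_ge_0; [lra | apply ex; lra | intros; apply Pf; lra]).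
      assert (RInt f u v <= I) by (apply le_I; lra).
      apply Rabs_def1; lra.
Qed.

Definition gamma_integrand (z t : R) : R := Rpower t (z - 1) * exp (- t).

Lemma is_derive_Rpower_base (p t : R) (Ht : 0 < t) :
  is_derive (fun t => Rpower t p) t (p * Rpower t (p - 1)).
Proof.
  unfold Rpower; auto_derive; [ exact Ht | ].
  replace ((p - 1) * ln t) with (p * ln t + - ln t) by ring.
  rewrite exp_plus, exp_Ropp, exp_ln by exact Ht; field; lra.
Qed.

Lemma gamma_integrand_continuous (z t : R) (Ht : 0 < t) :
  continuous (gamma_integrand z) t.
Proof.
  apply (ex_derive_continuous (gamma_integrand z)).
  unfold gamma_integrand, Rpower; auto_derive; exact Ht.
Qed.

Lemma gamma_integrand_pos (z t : R) : 0 < gamma_integrand z t.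
Proof. apply Rmult_lt_0_compat; apply exp_pos. Qed.

(** An algebraic majorant of [exp (- t)], of which the powers needed below have an
    elementary antiderivative.  It is the inequality [ln u <= u - 1] at
    [u = (1 + t) / p]. *)
Lemma exp_opp_le_Rpower (p : R) (Hp : 0 < p) :
  exists K, 0 < K /\ forall t, 0 < t -> exp (- t) <= K * Rpower (1 + t) (- p).
Proof.
  exists (exp (p * ln p + 1)); split; [ apply exp_pos | intros t Ht ].
  unfold Rpower; rewrite <- exp_plus.
  apply exp_le_compat.
  assert (H := exp_ineq1_le (ln ((1 + t) / p))).
  rewrite exp_ln, ln_div in H by (try apply Rdiv_lt_0_compat; lra).
  apply (Rmult_le_compat_l p) in H; [ | lra ].
  replace (p * ((1 + t) / p)) with (1 + t) in H by (field; lra).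
  lra.
Qed.

(** Both ends are handled at once: [t^(z-1) (1+t)^(-(z+1))] is the derivative of
    the bounded function [(t / (1+t))^z / z]. *)
Lemma RInt_gamma_integrand_bounded (z : R) (Hz : 0 < z) :
  exists M, forall u v, 0 < u -> u < v -> RInt (gamma_integrand z) u v <= M.
Proof.
  destruct (exp_opp_le_Rpower (z + 1)) as (K & HK & Hexp); [ lra | ].
  (* [h] majorises the integrand and [H] is its antiderivative. *)
  set (H := fun t => K / z * Rpower (t / (1 + t)) z).
  set (h := fun t => K * (Rpower t (z - 1) * Rpower (1 + t) (- (z + 1)))).
  assert (dH : forall t, 0 < t -> is_derive H t (h t)).
  { intros t Ht; unfold H, h, Rpower.
    assert (0 < t / (1 + t)) by (apply Rdiv_lt_0_compat; lra).
    auto_derive; [ split; [ lra | split; [ assumption | easy ] ] | ].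
    rewrite <- exp_plus.
    unfold Rdiv in *; rewrite ln_mult, ln_Rinv by (try apply Rinv_0_lt_compat; lra).
    replace ((z - 1) * ln t + - (z + 1) * ln (1 + t))
      with (z * (ln t + - ln (1 + t)) + - ln t + - ln (1 + t)) by ring.
    rewrite !exp_plus, !exp_Ropp, !exp_ln by lra.
    field; lra. }
  assert (Ch : forall t, 0 < t -> continuous h t).
  { intros t Ht; apply (ex_derive_continuous h).
    unfold h, Rpower; auto_derive; lra. }
  exists (K / z); intros u v Hu Hv.
  assert (E : is_RInt h u v (minus (H v) (H u))).
  { apply (is_RInt_derive H h u v); intros t [Ht _]; rewrite Rmin_left in Ht by lra;
      [ apply dH | apply Ch ]; lra. }
  apply Rle_trans with (RInt h u v).
  - apply RInt_le; [ lra | | now exists (minus (H v) (H u)) | ].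
    + apply (ex_RInt_continuous (gamma_integrand z)); intros t [Ht _].
      rewrite Rmin_left in Ht by lra; apply gamma_integrand_continuous; lra.
    + intros t Ht; unfold gamma_integrand, h.
      assert (E1 := Hexp t ltac:(lra)).
      apply (Rmult_le_compat_l (Rpower t (z - 1))) in E1;
        [ lra | left; apply exp_pos ].
  - rewrite (is_RInt_unique _ _ _ _ E); change (H v - H u <= K / z).
    assert (0 < K / z) by (apply Rdiv_lt_0_compat; lra).
    assert (0 < H u) by (apply Rmult_lt_0_compat; [ lra | apply exp_pos ]).
    enough (H v <= K / z * 1) by lra.
    apply Rmult_le_compat_l; [ lra | ].
    apply Rle_trans with (exp 0); [ apply exp_le_compat | rewrite exp_0; lra ].
    assert (ln (v / (1 + v)) <= 0); [ | nra ].
    apply Rle_trans with (ln 1); [ | rewrite ln_1; lra ].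
    apply Rcomplements.ln_le; [ apply Rdiv_lt_0_compat; lra | ].
    apply Rcomplements.Rle_div_l; lra.
Qed.

Lemma Gamma_is_sup (z : R) (Hz : 0 < z) :
  is_RInt_gen (gamma_integrand z) (at_right 0) (Rbar_locally p_infty) (Gamma z) /\
  (forall u v, 0 < u -> u < v -> RInt (gamma_integrand z) u v <= Gamma z) /\
  (forall K, (forall u v, 0 < u -> u < v -> RInt (gamma_integrand z) u v <= K) ->
    Gamma z <= K).
Proof.
  destruct (RInt_gamma_integrand_bounded z Hz) as [M HM].
  destruct (is_RInt_gen_nonneg_bounded (gamma_integrand z) M) as (I & HI & H).
  - intros; now apply gamma_integrand_continuous.
  - intros; left; apply gamma_integrand_pos.
  - exact HM.
  - assert (Gamma z = I) as -> by (apply (is_RInt_gen_unique (gamma_integrand z)), HI).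
    now split.
Qed.

Lemma Gamma_pos (z : R) (Hz : 0 < z) : 0 < Gamma z.
Proof.
  apply Rlt_le_trans with (RInt (gamma_integrand z) 1 2).
  - apply RInt_gt_0; [ lra | intros; apply gamma_integrand_pos | ].
    intros; apply gamma_integrand_continuous; lra.
  - apply Gamma_is_sup; lra.
Qed.

(** Integration by parts: [- t^z exp (- t)] vanishes at both ends and has derivative
    [t^z exp (- t) - z t^(z-1) exp (- t)]. *)
Lemma Gamma_succ (z : R) (Hz : 0 < z) : Gamma (z + 1) = z * Gamma z.
Proof.
  destruct (Gamma_is_sup z Hz) as [I0 _].
  destruct (Gamma_is_sup (z + 1)) as [I1 _]; [ lra | ].
  set (h := fun t => - (Rpower t z * exp (- t))).
  assert (dh : forall t, 0 < t -> is_derive h t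
             (minus (gamma_integrand (z + 1) t) (scal z (gamma_integrand z t)))).
  { intros t Ht.
    assert (D := is_derive_Rpower_base z t Ht).
    unfold h; evar_last.
    - apply (is_derive_opp (fun t => Rpower t z * exp (- t))).
      apply (is_derive_mult (fun t => Rpower t z) (fun t => exp (- t))); [ exact D | | ].
      + instantiate (1 := - exp (- t)); auto_derive; trivial; ring.
      + intros; apply Rmult_comm.
    - unfold gamma_integrand, opp, plus, mult, minus, scal, plus, opp; simpl.
      unfold mult; simpl.
      replace (z + 1 - 1) with z by ring; ring. }
  assert (inR : filter_prod (at_right 0) (Rbar_locally p_infty)
            (fun ab : R * R => 0 < fst ab /\ 0 < snd ab)).
  { apply (Filter_prod _ _ _ (fun u => 0 < u) (fun v => 0 < v)).
    - now exists (mkposreal 1 Rlt_0_1).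
    - now exists 0.
    - now intros. }
  assert (Rpl : forall ab t, 0 < fst ab /\ 0 < snd ab ->
             Rmin (fst ab) (snd ab) <= t -> 0 < t).
  { intros ab t [H1 H2]; apply Rmin_case; lra. }
  assert (I2 : is_RInt_gen (Derive h) (at_right 0) (Rbar_locally p_infty) (0 - 0)).
  { apply is_RInt_gen_Derive.
    - eapply filter_imp; [ | exact inR ]; intros ab Hab t [Ht _].
      eexists; apply dh; exact (Rpl ab t Hab Ht).
    - eapply filter_imp; [ | exact inR ]; intros ab Hab t [Ht _].
      assert (Ht' := Rpl ab t Hab Ht).
      apply continuous_ext_loc with
        (fun t => minus (gamma_integrand (z + 1) t) (scal z (gamma_integrand z t))).
      + exists (mkposreal t Ht'); intros y Hy; symmetry; apply is_derive_unique, dh.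
        change (Rabs (y - t) < t) in Hy; apply Rabs_def2 in Hy; lra.
      + apply (continuous_minus (gamma_integrand (z + 1))
                 (fun t => scal z (gamma_integrand z t))).
        * now apply gamma_integrand_continuous.
        * apply (continuous_scal_r z (gamma_integrand z)).
          now apply gamma_integrand_continuous.
    - apply filterlim_locally; intros eps.
      assert (0 < Rpower eps (/ z)) as Hd by apply exp_pos.
      exists (mkposreal _ Hd); intros t Ht H0t.
      change (Rabs (t - 0) < Rpower eps (/ z)) in Ht.
      rewrite Rminus_0_r, Rabs_pos_eq in Ht by lra.
      change (Rabs (h t - 0) < eps); unfold h.
      rewrite Rminus_0_r, Rabs_Ropp, Rabs_pos_eq
        by (left; apply Rmult_lt_0_compat; apply exp_pos).
      apply Rlt_le_trans with (Rpower t z * 1).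
      + apply Rmult_lt_compat_l; [ apply exp_pos | ].
        rewrite <- exp_0 at 1; apply exp_increasing; lra.
      + rewrite Rmult_1_r.
        replace (pos eps) with (Rpower (Rpower eps (/ z)) z).
        * apply Rle_Rpower_l; lra.
        * rewrite Rpower_mult, Rinv_l, Rpower_1; [ reflexivity | apply cond_pos | lra ].
    - destruct (exp_opp_le_Rpower (z + 1)) as (K & HK & Hexp); [ lra | ].
      apply filterlim_locally; intros eps.
      exists (K / eps); intros t Ht.
      assert (0 < K / eps) by (apply Rdiv_lt_0_compat; [ lra | apply cond_pos ]).
      assert (0 < t) as Ht0 by lra.
      change (Rabs (h t - 0) < eps); unfold h.
      rewrite Rminus_0_r, Rabs_Ropp, Rabs_pos_eq
        by (left; apply Rmult_lt_0_compat; apply exp_pos).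
      apply Rle_lt_trans with (K / (1 + t)).
      + apply Rle_trans with (Rpower (1 + t) z * (K * Rpower (1 + t) (- (z + 1)))).
        * apply Rmult_le_compat; try (left; apply exp_pos).
          -- apply Rle_Rpower_l; lra.
          -- now apply Hexp.
        * replace (Rpower (1 + t) z * (K * Rpower (1 + t) (- (z + 1))))
            with (K * (Rpower (1 + t) z * Rpower (1 + t) (- (z + 1)))) by ring.
          rewrite <- Rpower_plus.
          replace (z + - (z + 1)) with (- (1)) by ring.
          rewrite Rpower_Ropp, Rpower_1 by lra; unfold Rdiv; lra.
      + apply Rcomplements.Rlt_div_l; [ lra | ].
        apply Rcomplements.Rlt_div_l in Ht; [ | apply cond_pos ].
        assert (He := cond_pos eps); nra. }
  assert (I3 : is_RInt_gen (Derive h) (at_right 0) (Rbar_locally p_infty)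
            (minus (Gamma (z + 1)) (scal z (Gamma z)))).
  { assert (I4 := is_RInt_gen_minus _ _ _ _ I1 (is_RInt_gen_scal _ z _ I0)).
    refine (is_RInt_gen_ext _ _ _ _ I4).
    eapply filter_imp; [ | exact inR ]; intros ab Hab t [Ht _].
    symmetry; apply is_derive_unique, dh; exact (Rpl ab t Hab (Rlt_le _ _ Ht)). }
  apply (is_RInt_gen_unique (Derive h)) in I2, I3.
  rewrite I2 in I3.
  change (0 - 0 = Gamma (z + 1) - z * Gamma z) in I3; lra.
Qed.

Lemma exp_convex (p u v : R) (Hp : 0 <= p <= 1) :
  exp (p * u + (1 - p) * v) <= p * exp u + (1 - p) * exp v.
Proof.
  set (w := p * u + (1 - p) * v).
  assert (T : forall y, exp w * (1 + (y - w)) <= exp y).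
  { intros y; replace y with (w + (y - w)) at 2 by ring; rewrite exp_plus.
    apply Rmult_le_compat_l; [ left; apply exp_pos | apply exp_ineq1_le ]. }
  assert (H1 := T u); assert (H2 := T v).
  apply (Rmult_le_compat_l p) in H1; [ | lra ].
  apply (Rmult_le_compat_l (1 - p)) in H2; [ | lra ].
  unfold w in *; lra.
Qed.

(** * Log-convexity and the digamma function *)

Definition lnGamma (z : R) : R := ln (Gamma z).

Lemma exp_lnGamma (z : R) (Hz : 0 < z) : exp (lnGamma z) = Gamma z.
Proof. now apply exp_ln, Gamma_pos. Qed.

(** Hoelder's inequality for the gamma integral.  Each integrand is first divided
    by its integral; then convexity of [exp], applied pointwise, integrates to
    [p + (1 - p) = 1]. *)
Lemma lnGamma_convex (x y p : R) (Hx : 0 < x) (Hy : 0 < y) (Hp : 0 <= p <= 1) :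
  lnGamma (p * x + (1 - p) * y) <= p * lnGamma x + (1 - p) * lnGamma y.
Proof.
  set (w := p * x + (1 - p) * y).
  assert (Hw : 0 < w).
  { unfold w; destruct (Req_dec p 0) as [-> | Hp0]; [ lra | ].
    assert (0 < p * x) by (apply Rmult_lt_0_compat; lra).
    assert (0 <= (1 - p) * y) by (apply Rmult_le_pos; lra). lra. }
  set (L := p * lnGamma x + (1 - p) * lnGamma y).
  assert (Gx := Gamma_pos x Hx); assert (Gy := Gamma_pos y Hy).
  assert (pw : forall t, 0 < t -> gamma_integrand w t <=
     exp L * (p / Gamma x * gamma_integrand x t + (1 - p) / Gamma y * gamma_integrand y t)).
  { intros t Ht; unfold gamma_integrand, Rpower; rewrite <- !exp_plus.
    assert (E := exp_convex p ((x - 1) * ln t + - t - lnGamma x)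
                   ((y - 1) * ln t + - t - lnGamma y) Hp).
    apply (Rmult_le_compat_l (exp L)) in E; [ | left; apply exp_pos ].
    rewrite <- exp_plus in E.
    replace (L + _) with ((w - 1) * ln t + - t) in E by (unfold L, w; ring).
    assert (dv : forall c q, 0 < q -> exp (c - lnGamma q) = exp c / Gamma q).
    { intros c q Hq; unfold Rminus; now rewrite exp_plus, exp_Ropp, exp_lnGamma. }
    rewrite 2!dv in E by assumption.
    unfold Rdiv in *; lra. }
  enough (G : Gamma w <= exp L).
  { unfold lnGamma; rewrite <- (ln_exp L).
    apply Rcomplements.ln_le; [ now apply Gamma_pos | exact G ]. }
  destruct (Gamma_is_sup w Hw) as (_ & _ & lub); apply lub; intros u v Hu Hv.
  assert (ex : forall z, ex_RInt (gamma_integrand z) u v).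
  { intros z; apply (ex_RInt_continuous (gamma_integrand z)); intros t [Ht _].
    rewrite Rmin_left in Ht by lra; apply gamma_integrand_continuous; lra. }
  assert (I : forall z c, is_RInt (fun t => c * gamma_integrand z t) u v
                            (c * RInt (gamma_integrand z) u v)).
  { intros z c; apply (is_RInt_scal (gamma_integrand z)), (RInt_correct (gamma_integrand z)), ex. }
  assert (J := is_RInt_plus _ _ _ _ _ _ (I x (p / Gamma x)) (I y ((1 - p) / Gamma y))).
  apply (is_RInt_scal _ _ _ (exp L)) in J.
  apply Rle_trans with (1 := RInt_le _ _ _ _ (Rlt_le _ _ Hv) (ex w) (ex_intro _ _ J)
      (fun t Ht => pw t ltac:(lra))).
  rewrite (is_RInt_unique _ _ _ _ J).
  unfold scal, plus; simpl; unfold mult; simpl.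
  rewrite <- (Rmult_1_r (exp L)) at 2.
  apply Rmult_le_compat_l; [ left; apply exp_pos | ].
  destruct (Gamma_is_sup x Hx) as (_ & bx & _); specialize (bx u v Hu Hv).
  destruct (Gamma_is_sup y Hy) as (_ & by' & _); specialize (by' u v Hu Hv).
  apply (Rmult_le_compat_l (p / Gamma x)) in bx; [ | apply Rdiv_le_0_compat; lra ].
  apply (Rmult_le_compat_l ((1 - p) / Gamma y)) in by'; [ | apply Rdiv_le_0_compat; lra ].
  replace (p / Gamma x * Gamma x) with p in bx by (field; lra).
  replace ((1 - p) / Gamma y * Gamma y) with (1 - p) in by' by (field; lra).
  lra.
Qed.

Lemma ln_sub_le (u v : R) (Hu : 0 < u) (Hv : 0 < v) : ln v - ln u <= (v - u) / u.
Proof.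
  rewrite <- ln_div by assumption.
  assert (H := exp_ineq1_le (ln (v / u))).
  rewrite exp_ln in H by now apply Rdiv_lt_0_compat.
  replace ((v - u) / u) with (v / u - 1) by (field; lra); lra.
Qed.

Lemma is_lim_seq_const_div_INR_add (c x : R) :
  is_lim_seq (fun n => c / (INR n + x)) 0.
Proof.
  evar_last.
  - apply (is_lim_seq_scal_l (fun n => / (INR n + x)) c 0).
    evar_last.
    + apply is_lim_seq_inv.
      * apply is_lim_seq_plus with p_infty x;
          [ apply is_lim_seq_INR | apply is_lim_seq_const | reflexivity ].
      * easy.
    + reflexivity.
  - simpl; f_equal; ring.
Qed.

Lemma lnGamma_succ (x : R) (Hx : 0 < x) : lnGamma (x + 1) = ln x + lnGamma x.
Proof.
  unfold lnGamma; rewrite Gamma_succ, ln_mult by (try apply Gamma_pos; assumption).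
  reflexivity.
Qed.

Lemma lnGamma_three_points (u v w : R) (Hu : 0 < u) (Huv : u <= v) (Hvw : v <= w) (Huw : u < w) :
  (w - u) * lnGamma v <= (w - v) * lnGamma u + (v - u) * lnGamma w.
Proof.
  assert (H : 0 <= (w - v) / (w - u) <= 1).
  { split; [ apply Rdiv_le_0_compat; lra | apply Rcomplements.Rle_div_l; lra ]. }
  assert (C := lnGamma_convex u w _ Hu ltac:(lra) H).
  replace ((w - v) / (w - u) * u + (1 - (w - v) / (w - u)) * w) with v in C by (field; lra).
  apply (Rmult_le_compat_l (w - u)) in C; [ | lra ].
  apply Rle_trans with (1 := C); right; field; lra.
Qed.

(** By convexity every slope of a chord at [x] of length at most [1] lies between
    the slopes over [[x-1, x]] and [[x, x+1]], and the functional equation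
    evaluates these two as [ln (x-1)] and [ln x]. *)
Lemma lnGamma_slope_bounds (x h : R) (Hx : 1 < x) (Hh : h <> 0) (Hh1 : Rabs h <= 1) :
  ln (x - 1) <= (lnGamma (x + h) - lnGamma x) / h <= ln x.
Proof.
  assert (S1 := lnGamma_succ x ltac:(lra)).
  assert (S0 := lnGamma_succ (x - 1) ltac:(lra)).
  replace (x - 1 + 1) with x in S0 by ring.
  apply Rabs_le_between in Hh1.
  destruct (Rlt_or_le 0 h) as [Hp | Hn].
  - assert (A := lnGamma_three_points (x - 1) x (x + h)
                   ltac:(lra) ltac:(lra) ltac:(lra) ltac:(lra)).
    assert (B := lnGamma_three_points x (x + h) (x + 1)
                   ltac:(lra) ltac:(lra) ltac:(lra) ltac:(lra)).
    split; [ apply Rcomplements.Rle_div_r | apply Rcomplements.Rle_div_l ]; nra.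
  - replace ((lnGamma (x + h) - lnGamma x) / h)
      with ((lnGamma x - lnGamma (x + h)) / (- h)) by (field; lra).
    assert (A := lnGamma_three_points (x - 1) (x + h) x
                   ltac:(lra) ltac:(lra) ltac:(lra) ltac:(lra)).
    assert (B := lnGamma_three_points (x + h) x (x + 1)
                   ltac:(lra) ltac:(lra) ltac:(lra) ltac:(lra)).
    split; [ apply Rcomplements.Rle_div_r | apply Rcomplements.Rle_div_l ]; nra.
Qed.

Lemma ex_derive_lnGamma_sub_shift (m : nat) (x : R) (Hx : 0 < x) :
  ex_derive (fun y => lnGamma y - lnGamma (y + INR m)) x.
Proof.
  induction m as [ | m IH ].
  - apply ex_derive_ext with (fun _ => 0); [ | apply ex_derive_const ].
    intros t; symmetry; apply Rminus_diag_eq; simpl; now rewrite Rplus_0_r.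
  - apply ex_derive_ext_loc with
      (fun y => (lnGamma y - lnGamma (y + INR m)) - ln (y + INR m)).
    + exists (mkposreal x Hx); intros y Hy.
      change (Rabs (y - x) < x) in Hy; apply Rabs_def2 in Hy.
      assert (Hm := pos_INR m).
      rewrite S_INR, <- Rplus_assoc, lnGamma_succ by lra.
      lazymatch goal with |- ?u = ?v => change (@eq R u v) end; ring.
    + apply (ex_derive_minus (fun y => lnGamma y - lnGamma (y + INR m))); [ exact IH | ].
      auto_derive; assert (Hm := pos_INR m); lra.
Qed.

(** The difference quotients at [x] differ from those at [x + m] by quotients of
    an elementary function, which converge.  Those at [x + m] lie in an interval
    of length [ln (x+m) - ln (x+m-1)], which is as small as desired for large
    [m], so the quotients at [x] satisfy Cauchy's criterion. *)
Lemma ex_derive_lnGamma (x : R) (Hx : 0 < x) : ex_derive lnGamma x.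
Proof.
  set (q := fun h => (lnGamma (x + h) - lnGamma x) / h).
  assert (exists l : R, filterlim q (locally' 0) (locally l)) as [l Hl].
  { apply (proj1 (filterlim_locally_cauchy (U := R_CompleteSpace) (F := locally' 0)
                    (FF := Rbar_locally'_filter 0) q)); intros eps.
    assert (exists m, 1 < x + INR m /\ 2 / eps < x + INR m - 1) as (m & Hm1 & Hm2).
    { destruct (nfloor_ex (Rmax 2 (2 / eps + 1))) as [m [_ Hm]];
        [ apply Rle_trans with (2 := Rmax_l _ _); lra | ].
      exists (S m); rewrite S_INR.
      assert (H1 := Rmax_l 2 (2 / eps + 1)); assert (H2 := Rmax_r 2 (2 / eps + 1)); lra. }
    destruct (ex_derive_lnGamma_sub_shift m x Hx) as [d Hd].
    apply is_derive_Reals in Hd.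
    destruct (Hd (eps / 4)) as [del Hdel];
      [ assert (He := cond_pos eps); lra | ].
    assert (Hdp : 0 < Rmin 1 del) by (apply Rmin_case; [ lra | apply cond_pos ]).
    assert (key : forall h, h <> 0 -> Rabs h < Rmin 1 del ->
       ln (x + INR m - 1) + d - eps / 4 < q h < ln (x + INR m) + d + eps / 4).
    { intros h Hh0 Hh.
      assert (B := lnGamma_slope_bounds (x + INR m) h Hm1 Hh0
                (Rlt_le _ _ (Rlt_le_trans _ _ _ Hh (Rmin_l _ _)))).
      specialize (Hdel h Hh0 (Rlt_le_trans _ _ _ Hh (Rmin_r _ _))).
      apply Rabs_def2 in Hdel.
      replace (q h) with ((lnGamma (x + INR m + h) - lnGamma (x + INR m)) / h +
        (lnGamma (x + h) - lnGamma (x + h + INR m) - (lnGamma x - lnGamma (x + INR m))) / h).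
      - lra.
      - unfold q; replace (x + h + INR m) with (x + INR m + h) by ring; now field. }
    exists (fun h => h <> 0 /\ Rabs h < Rmin 1 del); split.
    - exists (mkposreal _ Hdp); intros h Hh Hh0; split; [ exact Hh0 | ].
      change (Rabs (h - 0) < Rmin 1 del) in Hh; now rewrite Rminus_0_r in Hh.
    - intros h k [Hh0 Hh] [Hk0 Hk].
      apply key in Hh; [ | exact Hh0 ]; apply key in Hk; [ | exact Hk0 ].
      change (Rabs (q k - q h) < eps).
      assert (L := ln_sub_le (x + INR m - 1) (x + INR m) ltac:(lra) ltac:(lra)).
      assert ((x + INR m - (x + INR m - 1)) / (x + INR m - 1) < eps / 2).
      { replace (x + INR m - (x + INR m - 1)) with 1 by ring.
        assert (He := cond_pos eps).
        apply Rcomplements.Rlt_div_l in Hm2; [ | exact He ].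
        apply Rcomplements.Rlt_div_l; lra. }
      apply Rabs_def1; lra. }
  exists l; apply is_derive_Reals; intros eps Heps.
  destruct (proj1 (filterlim_locally q l) Hl (mkposreal eps Heps)) as [del Hdel].
  exists del; intros h Hh0 Hh; apply Hdel; [ | exact Hh0 ].
  change (Rabs (h - 0) < del); now rewrite Rminus_0_r.
Qed.

Lemma is_derive_lnGamma (x : R) (Hx : 0 < x) : is_derive lnGamma x (Psi x).
Proof.
  assert (Hl := Derive_correct _ _ (ex_derive_lnGamma x Hx)).
  set (l := Derive lnGamma x) in *.
  assert (Gx := Gamma_pos x Hx).
  assert (D : is_derive Gamma x (Gamma x * l)).
  { apply is_derive_ext_loc with (fun y => exp (lnGamma y)).
    - exists (mkposreal x Hx); intros y Hy; apply exp_lnGamma.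
      change (Rabs (y - x) < x) in Hy; apply Rabs_def2 in Hy; lra.
    - evar_last.
      + apply (is_derive_comp exp lnGamma); [ | exact Hl ].
        instantiate (1 := Gamma x); rewrite <- exp_lnGamma by exact Hx.
        apply is_derive_exp.
      + apply Rmult_comm. }
  unfold Psi; rewrite (is_derive_unique _ _ _ D).
  now replace (Gamma x * l / Gamma x) with l by (field; lra).
Qed.

Lemma right_slope_le_derive (f : R -> R) (x l K d : R) (Hd : 0 < d) (D : is_derive f x l)
  (H : forall h, 0 < h < d -> f (x + h) - f x <= K * h) : l <= K.
Proof.
  apply Rnot_lt_le; intros Hlt.
  apply is_derive_Reals in D; destruct (D (l - K)) as [e He]; [ lra | ].
  assert (0 < Rmin d e) by (apply Rmin_case; [ exact Hd | apply cond_pos ]).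
  assert (H1 := Rmin_l d e); assert (H2 := Rmin_r d e).
  set (h := Rmin d e / 2) in *.
  specialize (He h ltac:(unfold h; lra)); specialize (H h ltac:(unfold h; lra)).
  rewrite Rabs_pos_eq in He by (unfold h; lra); specialize (He ltac:(unfold h; lra)).
  apply Rcomplements.Rle_div_l in H; [ | unfold h; lra ].
  apply Rabs_def2 in He; lra.
Qed.

Lemma right_slope_ge_derive (f : R -> R) (x l K d : R) (Hd : 0 < d) (D : is_derive f x l)
  (H : forall h, 0 < h < d -> K * h <= f (x + h) - f x) : K <= l.
Proof.
  apply Ropp_le_cancel, (right_slope_le_derive (fun y => - f y) x _ _ d Hd).
  - apply (is_derive_opp f), D.
  - intros h Hh; specialize (H h Hh); lra.
Qed.

Lemma Psi_bounds (x : R) (Hx : 1 < x) : ln (x - 1) <= Psi x <= ln x.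
Proof.
  assert (D := is_derive_lnGamma x ltac:(lra)).
  assert (B : forall h, 0 < h < 1 -> ln (x - 1) * h <= lnGamma (x + h) - lnGamma x <= ln x * h).
  { intros h Hh; assert (B := lnGamma_slope_bounds x h Hx ltac:(lra)).
    rewrite Rabs_pos_eq in B by lra; specialize (B ltac:(lra)); destruct B as [B1 B2].
    apply Rcomplements.Rle_div_r in B1; [ | lra ].
    apply Rcomplements.Rle_div_l in B2; lra. }
  split; [ apply (right_slope_ge_derive lnGamma x _ _ 1 Rlt_0_1 D)
         | apply (right_slope_le_derive lnGamma x _ _ 1 Rlt_0_1 D) ]; intros h Hh; now apply B.
Qed.

Lemma Psi_le (x y : R) (Hx : 0 < x) (Hxy : x <= y) : Psi x <= Psi y.
Proof.
  destruct (Rle_lt_or_eq_dec x y Hxy) as [Hlt | ->]; [ | lra ].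
  apply Rle_trans with ((lnGamma y - lnGamma x) / (y - x)).
  - apply (right_slope_le_derive lnGamma x _ _ (y - x)); [ lra | now apply is_derive_lnGamma | ].
    intros h Hh; replace ((lnGamma y - lnGamma x) / (y - x) * h)
      with (h * (lnGamma y - lnGamma x) / (y - x)) by (field; lra).
    apply Rcomplements.Rle_div_r; [ lra | ].
    assert (A := lnGamma_three_points x (x + h) y Hx ltac:(lra) ltac:(lra) Hlt); nra.
  - apply (right_slope_ge_derive lnGamma y _ _ 1); [ lra | apply is_derive_lnGamma; lra | ].
    intros h Hh; replace ((lnGamma y - lnGamma x) / (y - x) * h)
      with (h * (lnGamma y - lnGamma x) / (y - x)) by (field; lra).
    apply Rcomplements.Rle_div_l; [ lra | ].
    assert (A := lnGamma_three_points x y (y + h) Hx ltac:(lra) ltac:(lra) ltac:(lra)); nra.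
Qed.

Lemma Psi_succ (x : R) (Hx : 0 < x) : Psi (x + 1) = Psi x + / x.
Proof.
  assert (D1 : is_derive (fun y => lnGamma (y + 1)) x (Psi (x + 1))).
  { evar_last.
    - apply (is_derive_comp lnGamma (fun y => y + 1)).
      + apply is_derive_lnGamma; lra.
      + instantiate (1 := 1); auto_derive; trivial; ring.
    - apply Rmult_1_l. }
  assert (D2 : is_derive (fun y => lnGamma (y + 1)) x (/ x + Psi x)).
  { apply is_derive_ext_loc with (fun y => ln y + lnGamma y).
    - exists (mkposreal x Hx); intros y Hy.
      change (Rabs (y - x) < x) in Hy; apply Rabs_def2 in Hy.
      symmetry; apply lnGamma_succ; lra.
    - apply (is_derive_plus ln lnGamma);
        [ apply is_derive_ln | apply is_derive_lnGamma ]; exact Hx. }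
  apply is_derive_unique in D1, D2; lra.
Qed.

Lemma Psi_sub_ln_lim (x : R) (Hx : 0 < x) :
  is_lim_seq (fun n => Psi (x + INR (S n)) - ln (INR (S n))) 0.
Proof.
  apply is_lim_seq_le_le with (fun n => (- 1) / (INR n + x)) (fun n => x / (INR n + 1));
    [ | apply is_lim_seq_const_div_INR_add .. ].
  intros n; rewrite S_INR; assert (Hn := pos_INR n).
  assert (B := Psi_bounds (x + (INR n + 1)) ltac:(lra)).
  replace (x + (INR n + 1) - 1) with (INR n + x) in B by ring.
  assert (L1 := ln_sub_le (INR n + x) (INR n + 1) ltac:(lra) ltac:(lra)).
  assert (L2 := ln_sub_le (INR n + 1) (x + (INR n + 1)) ltac:(lra) ltac:(lra)).
  replace (x + (INR n + 1) - (INR n + 1)) with x in L2 by ring.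
  assert ((INR n + 1 - (INR n + x)) / (INR n + x) <= 1 / (INR n + x)).
  { apply Rmult_le_compat_r; [ left; apply Rinv_0_lt_compat | ]; lra. }
  replace (- 1 / (INR n + x)) with (- (1 / (INR n + x))) by (field; lra).
  lra.
Qed.

(** [Psi (1 + N) - Psi 1] is the [N]-th harmonic number and [Psi (1 + N) - ln N]
    tends to [0]; in particular the limit that defines [euler_gamma] exists. *)
Lemma Psi_1 : Psi 1 = - euler_gamma.
Proof.
  unfold euler_gamma.
  rewrite (is_lim_seq_unique _ (- Psi 1)); [ simpl; ring | ].
  assert (H : forall n, sum_n (fun k => / INR (S k)) n = Psi (1 + INR (S n)) - Psi 1).
  { induction n as [ | n IH ].
    - rewrite sum_O; simpl; rewrite Psi_succ by lra; field.
    - rewrite sum_Sn, IH, (S_INR (S n)), <- Rplus_assoc, Psi_succ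
        by (assert (Hn := pos_INR (S n)); lra).
      unfold plus; simpl plus; rewrite (Rplus_comm 1 (INR (S n))), <- (S_INR (S n)); simpl; ring. }
  apply is_lim_seq_ext with (fun n => (Psi (1 + INR (S n)) - ln (INR (S n))) - Psi 1).
  - intros n; rewrite H; ring.
  - evar_last.
    + apply is_lim_seq_minus'; [ apply Psi_sub_ln_lim; lra | apply is_lim_seq_const ].
    + f_equal; ring.
Qed.

(** The recurrence makes [Psi (1/2 + n) + Psi (1 + n) - 2 Psi (1 + 2 n)]
    independent of [n]; its limit is [- 2 ln 2]. *)
Lemma Psi_half : Psi (1 / 2) = - euler_gamma - 2 * ln 2.
Proof.
  assert (H : forall n, Psi (1 / 2 + INR n) + Psi (1 + INR n) - 2 * Psi (1 + INR (2 * n))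
              = Psi (1 / 2) - Psi 1).
  { induction n as [ | n IH ]; [ simpl; rewrite !Rplus_0_r; ring | ].
    rewrite <- IH; replace (2 * S n)%nat with (S (S (2 * n))) by lia.
    assert (Hn := pos_INR n); assert (Hn2 := pos_INR (2 * n)).
    rewrite !S_INR, <- !Rplus_assoc, !Psi_succ by lra.
    rewrite mult_INR; simpl (INR 2); field; lra. }

  assert (L : is_lim_seq (fun _ : nat => Psi (1 / 2) - Psi 1) (0 + 0 - 2 * 0 - 2 * ln 2)).
  { apply is_lim_seq_ext with (fun n =>
      (Psi (1 / 2 + INR (S n)) - ln (INR (S n))) + (Psi (1 + INR (S n)) - ln (INR (S n)))
      - 2 * (Psi (1 + INR (S (S (2 * n)))) - ln (INR (S (S (2 * n))))) - 2 * ln 2).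
    - intros n; rewrite <- (H (S n)); replace (2 * S n)%nat with (S (S (2 * n))) by lia.
      replace (INR (S (S (2 * n)))) with (2 * INR (S n)).
      + rewrite ln_mult; [ ring | lra | apply lt_0_INR; lia ].
      + replace (S (S (2 * n))) with (2 * S n)%nat by lia; rewrite mult_INR; simpl; ring.
    - apply is_lim_seq_minus'; [ | apply is_lim_seq_const ].
      apply is_lim_seq_minus'; [ apply is_lim_seq_plus' | ]; try (apply Psi_sub_ln_lim; lra).
      apply (is_lim_seq_scal_l _ 2 0).
      apply (is_lim_seq_subseq (fun n => Psi (1 + INR (S n)) - ln (INR (S n))) 0
               (fun n => S (2 * n))); [ | apply Psi_sub_ln_lim; lra ].
      apply eventually_subseq; intros n; lia. }
  apply is_lim_seq_unique in L; rewrite Lim_seq_const in L; injection L as L.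
  rewrite Psi_1 in L; lra.
Qed.

(** * Normalised coefficients and their partial sums *)

Lemma Gamma_1 : Gamma 1 = 1.
Proof.
  destruct (Gamma_is_sup 1 Rlt_0_1) as (_ & ub & lub).
  assert (I : forall u v, 0 < u -> u < v -> RInt (gamma_integrand 1) u v = exp (- u) - exp (- v)).
  { intros u v Hu Hv; apply is_RInt_unique.
    apply is_RInt_ext with (fun t => exp (- t)).
    - intros t [Ht _]; rewrite Rmin_left in Ht by lra; unfold gamma_integrand.
      replace (1 - 1) with 0 by ring; rewrite Rpower_O by lra; symmetry; apply Rmult_1_l.
    - evar_last.
      + apply (is_RInt_derive (fun t => - exp (- t)) (fun t => exp (- t))).
        * intros t _; auto_derive; trivial; ring.
        * intros t _; apply (ex_derive_continuous (fun t => exp (- t))); auto_derive; trivial.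
      + unfold minus, plus, opp; simpl; ring. }
  apply Rle_antisym.
  - apply lub; intros u v Hu Hv; rewrite I by assumption.
    assert (exp (- u) < exp 0) by (apply exp_increasing; lra).
    assert (0 < exp (- v)) by apply exp_pos.
    rewrite exp_0 in *; lra.
  - apply le_epsilon; intros eps Heps.
    set (e := Rmin 1 eps).
    assert (He : 0 < e) by (apply Rmin_case; lra).
    assert (He1 := Rmin_l 1 eps); assert (He2 := Rmin_r 1 eps); fold e in He1, He2.
    assert (Hv : 1 < 2 / e) by (apply Rcomplements.Rlt_div_r; lra).
    specialize (ub (e / 2) (2 / e) ltac:(lra) ltac:(lra)); rewrite I in ub by lra.
    assert (E1 := exp_ineq1_le (- (e / 2))).
    assert (E2 := exp_ineq1_le (2 / e)).
    assert (exp (- (2 / e)) <= e / 2).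
    { rewrite exp_Ropp; replace (e / 2) with (/ (2 / e)) by (field; lra).
      apply Rinv_le_contravar; lra. }
    lra.
Qed.

Lemma Gamma_shifted_fact (a : R) (n : nat) (Ha : 0 < a) :
  Gamma (a + INR n) = Gamma a * shifted_fact a n.
Proof.
  induction n as [ | n IH ]; [ simpl; rewrite Rplus_0_r; ring | ].
  rewrite S_INR, <- Rplus_assoc, Gamma_succ, IH by (assert (Hn := pos_INR n); lra).
  simpl; ring.
Qed.

Lemma shifted_fact_pos (a : R) (n : nat) (Ha : 0 < a) : 0 < shifted_fact a n.
Proof.
  induction n as [ | n IH ]; simpl; [ lra | ].
  apply Rmult_lt_0_compat; [ exact IH | assert (Hn := pos_INR n); lra ].
Qed.

Lemma shifted_fact_1 (n : nat) : shifted_fact 1 n = INR (fact n).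
Proof.
  induction n as [ | n IH ]; [ reflexivity | ].
  rewrite fact_simpl, mult_INR, S_INR, <- IH; simpl; ring.
Qed.

(** [Beta a b] times the [n]-th coefficient of [F(a,b;a+b;.)].  In this
    normalisation the terms are asymptotic to [1/n] for all parameters. *)
Definition gamma_term (a b : R) (n : nat) : R :=
  Gamma (a + INR n) * Gamma (b + INR n) / (Gamma (a + b + INR n) * INR (fact n)).

Lemma gamma_term_sym (a b : R) (n : nat) : gamma_term a b n = gamma_term b a n.
Proof. unfold gamma_term; rewrite (Rplus_comm b a); f_equal; ring. Qed.

Lemma gamma_term_pos (a b : R) (n : nat) (Ha : 0 < a) (Hb : 0 < b) : 0 < gamma_term a b n.
Proof.
  assert (Hn := pos_INR n); assert (Hf := INR_fact_lt_0 n).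
  apply Rdiv_lt_0_compat; apply Rmult_lt_0_compat; try apply Gamma_pos; lra.
Qed.

Lemma gamma_term_succ (a b : R) (n : nat) (Ha : 0 < a) (Hb : 0 < b) :
  gamma_term a b (S n) =
  gamma_term a b n * ((a + INR n) * (b + INR n) / ((a + b + INR n) * (INR n + 1))).
Proof.
  unfold gamma_term; rewrite fact_simpl, mult_INR, !S_INR, <- !Rplus_assoc.
  assert (Hn := pos_INR n); assert (Hf := INR_fact_lt_0 n).
  rewrite !Gamma_succ by lra.
  assert (Hg := Gamma_pos (a + b + INR n) ltac:(lra)).
  field; lra.
Qed.

Lemma gamma_term_succ_param (a b : R) (n : nat) (Ha : 0 < a) (Hb : 0 < b) :
  gamma_term (a + 1) b n = gamma_term a b n * ((a + INR n) / (a + b + INR n)).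
Proof.
  unfold gamma_term; assert (Hn := pos_INR n); assert (Hf := INR_fact_lt_0 n).
  replace (a + 1 + INR n) with (a + INR n + 1) by ring.
  replace (a + 1 + b + INR n) with (a + b + INR n + 1) by ring.
  rewrite !Gamma_succ by lra.
  assert (Hg := Gamma_pos (a + b + INR n) ltac:(lra)).
  field; lra.
Qed.

Lemma lnGamma_increment (x h : R) (Hx : 0 < x) (Hh : 0 <= h) :
  h * Psi x <= lnGamma (x + h) - lnGamma x <= h * Psi (x + h).
Proof.
  destruct (MVT_gen lnGamma x (x + h) Psi) as (c & Hc & E).
  - rewrite Rmin_left, Rmax_right by lra; intros y Hy; apply is_derive_lnGamma; lra.
  - rewrite Rmin_left, Rmax_right by lra; intros y Hy.
    apply continuity_pt_filterlim, (ex_derive_continuous lnGamma), ex_derive_lnGamma; lra.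
  - rewrite Rmin_left, Rmax_right in Hc by lra.
    rewrite E; replace (x + h - x) with h by ring.
    assert (P1 := Psi_le x c Hx ltac:(lra)); assert (P2 := Psi_le c (x + h) ltac:(lra) ltac:(lra)).
    split; nra.
Qed.

(** Increments of a convex function grow with the base point. *)
Lemma lnGamma_increment_le (x y h : R) (Hx : 0 < x) (Hxy : x <= y) (Hh : 0 <= h) :
  lnGamma (x + h) - lnGamma x <= lnGamma (y + h) - lnGamma y.
Proof.
  set (g := fun t => lnGamma (t + h) - lnGamma t).
  assert (dg : forall t, 0 < t -> is_derive g t (Psi (t + h) - Psi t)).
  { intros t Ht; apply (is_derive_minus (fun t => lnGamma (t + h)) lnGamma);
      [ | now apply is_derive_lnGamma ].
    evar_last.
    - apply (is_derive_comp lnGamma (fun y => y + h)).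
      + apply is_derive_lnGamma; lra.
      + instantiate (1 := 1); auto_derive; trivial; ring.
    - apply Rmult_1_l. }
  change (g x <= g y).
  destruct (MVT_gen g x y (fun t => Psi (t + h) - Psi t)) as (c & Hc & E).
  - rewrite Rmin_left by lra; intros t Ht; apply dg; lra.
  - rewrite Rmin_left by lra; intros t Ht.
    apply continuity_pt_filterlim, (ex_derive_continuous g).
    eexists; apply dg; lra.
  - rewrite Rmin_left, Rmax_right in Hc by lra.
    assert (P := Psi_le c (c + h) ltac:(lra) ltac:(lra)); nra.
Qed.

Lemma gamma_term_exp (a b : R) (n : nat) (Ha : 0 < a) (Hb : 0 < b) :
  gamma_term a b n =
  exp (lnGamma (a + INR n) + lnGamma (b + INR n) - lnGamma (a + b + INR n)) / INR (fact n).
Proof.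
  assert (Hn := pos_INR n); assert (Hf := INR_fact_lt_0 n).
  unfold Rminus; rewrite !exp_plus, exp_Ropp, !exp_lnGamma by lra.
  assert (Hg := Gamma_pos (a + b + INR n) ltac:(lra)).
  unfold gamma_term; field; lra.
Qed.

(** [T_n] decreases in [a] because [lnGamma] is convex. *)
Lemma gamma_term_antitone (a a' b : R) (n : nat) (Ha : 0 < a) (Haa' : a <= a') (Hb : 0 < b) :
  gamma_term a' b n <= gamma_term a b n.
Proof.
  rewrite !gamma_term_exp by lra.
  apply Rmult_le_compat_r; [ left; apply Rinv_0_lt_compat, INR_fact_lt_0 | ].
  apply exp_le_compat; assert (Hn := pos_INR n).
  assert (L := lnGamma_increment_le (a + INR n) (a' + INR n) b ltac:(lra) ltac:(lra) ltac:(lra)).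
  replace (a + INR n + b) with (a + b + INR n) in L by ring.
  replace (a' + INR n + b) with (a' + b + INR n) in L by ring.
  lra.
Qed.

(** The logarithm of [N T_N] is the difference of the increments of [lnGamma] of
    length [a] starting at [N] and at [b + N].  Both are [a] times values of
    [Psi] between [N] and [a + b + N], where [Psi] varies by [o(1)]. *)
Lemma is_lim_seq_INR_mul_gamma_term (a b : R) (Ha : 0 < a) (Hb : 0 < b) :
  is_lim_seq (fun n => INR n * gamma_term a b n) 1.
Proof.
  set (e := fun n => let N := INR (S (S n)) in
    lnGamma (a + N) + lnGamma (b + N) - lnGamma (a + b + N) - lnGamma N).
  apply (is_lim_seq_incr_n _ 2).
  apply is_lim_seq_ext with (fun n => exp (e n)).
  { intros n; replace (n + 2)%nat with (S (S n)) by lia; unfold e.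
    rewrite gamma_term_exp by assumption; set (N := S (S n)).
    assert (HN : 0 < INR N) by (apply lt_0_INR; unfold N; lia).
    unfold Rminus at 1; rewrite exp_plus, exp_Ropp, (exp_lnGamma (INR N)) by exact HN.
    assert (INR (fact N) = INR N * Gamma (INR N)) as ->.
    { assert (E := Gamma_shifted_fact 1 N Rlt_0_1).
      rewrite Gamma_1, shifted_fact_1, Rplus_comm, Gamma_succ in E by exact HN; lra. }
    assert (Hg := Gamma_pos (INR N) HN); field; lra. }
  rewrite <- exp_0; apply (is_lim_seq_continuous exp);
    [ apply derivable_continuous, derivable_exp | ].
  set (g := fun n => a * ((Psi (a + b + 1 + INR (S n)) - ln (INR (S n)))
                        - (Psi (1 + INR (S n)) - ln (INR (S n))))).
  assert (Lg : is_lim_seq g 0).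
  { evar_last.
    - apply (is_lim_seq_scal_l _ a), is_lim_seq_minus'; apply Psi_sub_ln_lim; lra.
    - simpl; f_equal; ring. }
  apply is_lim_seq_le_le with (fun n => - g n) g; [ | | exact Lg ].
  - intros n; unfold e, g.
    assert (Hn := pos_INR n).
    replace (1 + INR (S n)) with (INR (S (S n))) by (rewrite (S_INR (S n)); ring).
    replace (a + b + 1 + INR (S n)) with (a + b + INR (S (S n))) by (rewrite (S_INR (S n)); ring).
    set (N := INR (S (S n))).
    assert (HN : 0 < N) by (apply lt_0_INR; lia).
    assert (I1 := lnGamma_increment N a HN ltac:(lra)).
    assert (I2 := lnGamma_increment (b + N) a ltac:(lra) ltac:(lra)).
    replace (N + a) with (a + N) in I1 by ring.
    replace (b + N + a) with (a + b + N) in I2 by ring.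
    assert (M1 := Psi_le (a + N) (a + b + N) ltac:(lra) ltac:(lra)).
    assert (M2 := Psi_le N (b + N) ltac:(lra) ltac:(lra)).
    split; nra.
  - evar_last; [ apply (is_lim_seq_opp g 0), Lg | simpl; f_equal; ring ].
Qed.

(** Telescoping: [T_n(a,b) - T_n(a+1,b)] equals
    [((n+1) T_(n+1)(a,b) - n T_n(a,b)) / a]. *)
Lemma sum_n_gamma_term_sub_succ (a b : R) (N : nat) (Ha : 0 < a) (Hb : 0 < b) :
  sum_n (gamma_term a b) N - sum_n (gamma_term (a + 1) b) N =
  / a * (INR (S N) * gamma_term a b (S N)).
Proof.
  induction N as [ | N IH ].
  - rewrite !sum_O, gamma_term_succ, gamma_term_succ_param by assumption.
    simpl INR; field; lra.
  - rewrite !sum_Sn; change (@plus R_AbelianMonoid) with Rplus.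
    replace (sum_n (gamma_term a b) N) with (sum_n (gamma_term (a + 1) b) N +
      / a * (INR (S N) * gamma_term a b (S N))) by (rewrite <- IH; simpl; ring).
    rewrite (gamma_term_succ a b (S N)), gamma_term_succ_param by assumption.
    rewrite (S_INR (S N)); assert (Hn := pos_INR (S N)); field; lra.
Qed.

Lemma sum_n_gamma_term_sub_shift_lim (a b : R) (p : nat) (Ha : 0 < a) (Hb : 0 < b) :
  is_lim_seq (fun N => sum_n (gamma_term a b) N - sum_n (gamma_term (a + INR p) b) N)
    (Psi (a + INR p) - Psi a).
Proof.
  induction p as [ | p IH ].
  - apply is_lim_seq_ext with (fun _ => 0).
    + intros n; simpl; rewrite Rplus_0_r; ring.
    + replace (Psi (a + INR 0) - Psi a) with 0 by (simpl; rewrite Rplus_0_r; ring).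
      apply is_lim_seq_const.
  - assert (Hp := pos_INR p).
    apply is_lim_seq_ext with (fun N =>
      (sum_n (gamma_term a b) N - sum_n (gamma_term (a + INR p) b) N) +
      / (a + INR p) * (INR (S N) * gamma_term (a + INR p) b (S N))).
    { intros N; rewrite <- sum_n_gamma_term_sub_succ by lra.
      rewrite S_INR, <- Rplus_assoc; ring. }
    rewrite S_INR, <- Rplus_assoc, Psi_succ by lra.
    replace (Psi (a + INR p) + / (a + INR p) - Psi a)
      with ((Psi (a + INR p) - Psi a) + / (a + INR p) * 1) by ring.
    apply is_lim_seq_plus'; [ exact IH | ].
    apply (is_lim_seq_scal_l _ (/ (a + INR p)) 1).
    apply (is_lim_seq_incr_1 (fun N => INR N * gamma_term (a + INR p) b N)).
    apply is_lim_seq_INR_mul_gamma_term; lra.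
Qed.

Lemma sum_n_gamma_term_antitone (a a' b : R) (N : nat) (Ha : 0 < a) (Haa' : a <= a') (Hb : 0 < b) :
  sum_n (gamma_term a' b) N <= sum_n (gamma_term a b) N.
Proof. apply sum_n_m_le; intros n; now apply gamma_term_antitone. Qed.

(** Shift both parameters by a large integer [m], where the limit is known.  What
    remains is a difference at [a + m] and [a' + m].  By monotonicity it lies
    between [0] and the difference at [a + m] and [a + m + q], with [q] an
    integer at least [a' - a]; this tends to [Psi (a+m+q) - Psi (a+m)], which is
    small.  This also proves that the limit exists. *)
Lemma sum_n_gamma_term_sub_lim_le (a a' b : R) (Ha : 0 < a) (Haa' : a <= a') (Hb : 0 < b) :
  is_lim_seq (fun N => sum_n (gamma_term a b) N - sum_n (gamma_term a' b) N)
    (Psi a' - Psi a).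
Proof.
  destruct (nfloor_ex (a' - a)) as [p [_ Hp]]; [ lra | ].
  rewrite <- S_INR in Hp; set (q := S p) in *.
  apply is_lim_seq_spec; intros eps; assert (He := cond_pos eps).
  assert (exists m, Psi (a + INR m + INR q) - Psi (a + INR m) < eps / 4) as [m Hm].
  { assert (L : is_lim_seq (fun n => (Psi (a + INR q + INR (S n)) - ln (INR (S n)))
                   - (Psi (a + INR (S n)) - ln (INR (S n)))) 0).
    { evar_last.
      - assert (Hq := pos_INR q).
        apply is_lim_seq_minus'; apply Psi_sub_ln_lim; lra.
      - f_equal; ring. }
    apply is_lim_seq_spec in L; destruct (L (mkposreal (eps / 4) ltac:(lra))) as [n Hn].
    exists (S n); specialize (Hn n (le_n n)); simpl pos in Hn; apply Rabs_def2 in Hn.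
    replace (a + INR (S n) + INR q) with (a + INR q + INR (S n)) by ring; lra. }
  assert (Hm0 := pos_INR m).
  assert (L1 := sum_n_gamma_term_sub_shift_lim a b m Ha Hb).
  assert (L2 := sum_n_gamma_term_sub_shift_lim a' b m ltac:(lra) Hb).
  assert (L3 := sum_n_gamma_term_sub_shift_lim (a + INR m) b q ltac:(lra) Hb).
  apply is_lim_seq_spec in L1, L2, L3.
  set (e8 := mkposreal (eps / 8) ltac:(lra)).
  specialize (L1 e8); specialize (L2 e8); specialize (L3 e8).
  generalize (filter_and _ _ L1 (filter_and _ _ L2 L3)); clear L1 L2 L3.
  apply filter_imp; intros N (H1 & H2 & H3); simpl pos in *.
  assert (M1 := sum_n_gamma_term_antitone (a + INR m) (a' + INR m) b N ltac:(lra) ltac:(lra) Hb).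
  assert (M2 := sum_n_gamma_term_antitone (a' + INR m) (a + INR m + INR q) b N
                  ltac:(lra) ltac:(lra) Hb).
  assert (P1 := Psi_le (a + INR m) (a' + INR m) ltac:(lra) ltac:(lra)).
  assert (P2 := Psi_le (a' + INR m) (a + INR m + INR q) ltac:(lra) ltac:(lra)).
  apply Rabs_def2 in H1, H2, H3.
  apply Rabs_def1; lra.
Qed.

Lemma sum_n_gamma_term_sub_lim (a b a' b' : R)
  (Ha : 0 < a) (Hb : 0 < b) (Ha' : 0 < a') (Hb' : 0 < b') :
  is_lim_seq (fun N => sum_n (gamma_term a b) N - sum_n (gamma_term a' b') N)
    ((Psi a' - Psi a) + (Psi b' - Psi b)).
Proof.
  assert (L : forall a a' b, 0 < a -> 0 < a' -> 0 < b ->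
    is_lim_seq (fun N => sum_n (gamma_term a b) N - sum_n (gamma_term a' b) N) (Psi a' - Psi a)).
  { clear; intros a a' b Ha Ha' Hb.
    destruct (Rle_or_lt a a') as [H | H]; [ now apply sum_n_gamma_term_sub_lim_le | ].
    apply is_lim_seq_ext with
      (fun N => - (sum_n (gamma_term a' b) N - sum_n (gamma_term a b) N)); [ intros; ring | ].
    replace (Psi a' - Psi a) with (- (Psi a - Psi a')) by ring.
    apply (is_lim_seq_opp _ (Psi a - Psi a')), sum_n_gamma_term_sub_lim_le; lra. }
  apply is_lim_seq_ext with (fun N =>
    (sum_n (gamma_term a b) N - sum_n (gamma_term a' b) N) +
    (sum_n (gamma_term b a') N - sum_n (gamma_term b' a') N)).
  - intros N.
    rewrite (sum_n_ext (gamma_term b a') (gamma_term a' b)) by (intros; apply gamma_term_sym).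
    rewrite (sum_n_ext (gamma_term b' a') (gamma_term a' b')) by (intros; apply gamma_term_sym).
    ring.
  - apply is_lim_seq_plus'; now apply L.
Qed.

(** * Wallis' product *)

Definition wallis (n : nat) : R := RInt (fun t => sin t ^ n) 0 (PI / 2).

Lemma ex_RInt_sin_pow (n : nat) (u v : R) : ex_RInt (fun t => sin t ^ n) u v.
Proof.
  apply (ex_RInt_continuous (fun t => sin t ^ n)); intros t _.
  apply (ex_derive_continuous (fun t => sin t ^ n)); auto_derive; trivial.
Qed.

(** Integrate the derivative of [cos t * sin t ^ (n+1)], a function which vanishes
    at both ends of [[0, PI/2]]. *)
Lemma wallis_rec (n : nat) : (INR n + 2) * wallis (n + 2) = (INR n + 1) * wallis n.
Proof.
  set (f := fun t => minus (scal (INR n + 1) (sin t ^ n)) (scal (INR n + 2) (sin t ^ (n + 2)))).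
  assert (J : is_RInt f 0 (PI / 2) 0).
  { evar_last.
    - apply (is_RInt_derive (fun t => cos t * sin t ^ (n + 1))).
      + intros t _; auto_derive; trivial.
        unfold f, minus, plus, opp, scal; simpl; unfold mult; simpl.
        replace (n + 1)%nat with (S n) by lia; replace (n + 2)%nat with (S (S n)) by lia.
        rewrite S_INR; simpl.
        assert (E : cos t * cos t = 1 - sin t * sin t)
          by (assert (E := sin2_cos2 t); unfold Rsqr in E; lra).
        transitivity ((cos t * cos t) * ((INR n + 1) * sin t ^ n) - sin t * sin t * sin t ^ n);
          [ ring | rewrite E; ring ].
      + intros t _.
        apply (ex_derive_continuous f).
        unfold f, minus, plus, opp, scal; simpl; unfold mult; simpl; auto_derive; trivial.
    - unfold minus, plus, opp; simpl; rewrite cos_PI2, sin_0, pow_i by lia; ring. }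
  assert (K := is_RInt_minus _ _ _ _ _ _
     (is_RInt_scal _ _ _ (INR n + 1) _ (RInt_correct _ _ _ (ex_RInt_sin_pow n 0 (PI / 2))))
     (is_RInt_scal _ _ _ (INR n + 2) _ (RInt_correct _ _ _ (ex_RInt_sin_pow (n + 2) 0 (PI / 2))))).
  assert (E := eq_trans (eq_sym (is_RInt_unique _ _ _ _ J)) (is_RInt_unique _ _ _ _ K)).
  change (0 = (INR n + 1) * wallis n - (INR n + 2) * wallis (n + 2)) in E; lra.
Qed.

Lemma wallis_succ_le (n : nat) : wallis (S n) <= wallis n.
Proof.
  assert (HP := PI_RGT_0).
  apply RInt_le; [ lra | apply ex_RInt_sin_pow .. | ].
  intros t Ht; simpl.
  assert (0 < sin t) by (apply sin_gt_0; lra).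
  assert (0 < sin t ^ n) by now apply pow_lt.
  assert (B := SIN_bound t); nra.
Qed.

Lemma wallis_0 : wallis 0 = PI / 2.
Proof.
  unfold wallis; simpl; rewrite RInt_const; unfold scal; simpl; unfold mult; simpl; ring.
Qed.

Lemma wallis_1 : wallis 1 = 1.
Proof.
  apply is_RInt_unique; evar_last.
  - apply (is_RInt_derive (fun t => - cos t)).
    + intros t _; auto_derive; trivial; ring.
    + intros t _; apply (ex_derive_continuous (fun t => sin t ^ 1)); auto_derive; trivial.
  - unfold minus, plus, opp; simpl; rewrite cos_PI2, cos_0; ring.
Qed.

(** By the recurrence this product does not depend on [n]. *)
Lemma wallis_product (n : nat) : (INR n + 1) * (wallis (S n) * wallis n) = PI / 2.
Proof.
  induction n as [ | n IH ]; [ simpl INR; rewrite wallis_0, wallis_1; ring | ].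
  rewrite <- IH; assert (E := wallis_rec n); replace (n + 2)%nat with (S (S n)) in E by lia.
  transitivity (wallis (S n) * ((INR n + 2) * wallis (S (S n))));
    [ rewrite S_INR; ring | rewrite E; ring ].
Qed.

Lemma wallis_even (n : nat) : wallis (2 * n) = PI / 2 * (shifted_fact (1 / 2) n / INR (fact n)).
Proof.
  induction n as [ | n IH ]; [ simpl; rewrite wallis_0; field | ].
  assert (E := wallis_rec (2 * n)); rewrite IH, mult_INR in E; simpl (INR 2) in E.
  replace (2 * S n)%nat with (2 * n + 2)%nat by lia.
  rewrite fact_simpl, mult_INR, S_INR; simpl shifted_fact.
  assert (Hn := pos_INR n); assert (Hf := INR_fact_lt_0 n).
  apply Rmult_eq_reg_l with ((1 + 1) * INR n + 2); [ rewrite E; field; lra | lra ].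
Qed.

(** Two evaluations of the limit of [n T_n(1/2,1/2)].  It is [1] by the general
    asymptotics.  On the other hand [T_n(1/2,1/2)] is [Gamma(1/2)^2] times a
    square which Wallis' inequalities show to be equivalent to [1 / (PI n)]. *)
Lemma Gamma_half_sqr : Gamma (1 / 2) * Gamma (1 / 2) = PI.
Proof.
  assert (HP := PI_RGT_0).
  assert (Hg := Gamma_pos (1 / 2) ltac:(lra)); set (g := Gamma (1 / 2) * Gamma (1 / 2)).
  assert (Hgg : 0 < g) by now apply Rmult_lt_0_compat.
  assert (L := is_lim_seq_INR_mul_gamma_term (1 / 2) (1 / 2) ltac:(lra) ltac:(lra)).
  assert (E : forall n, INR n * gamma_term (1 / 2) (1 / 2) n
              = 4 * g / (PI * PI) * (INR n * (wallis (2 * n) * wallis (2 * n)))).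
  { intros n; rewrite wallis_even; unfold gamma_term.
    replace (1 / 2 + 1 / 2) with 1 by field.
    rewrite !Gamma_shifted_fact, shifted_fact_1, Gamma_1 by lra.
    assert (Hf := INR_fact_lt_0 n); unfold g; field; lra. }
  assert (L2 : is_lim_seq (fun n => INR n * gamma_term (1 / 2) (1 / 2) n) (g / PI)).
  { apply (is_lim_seq_incr_1 _ (g / PI)).
    apply is_lim_seq_le_le with
      (fun n => g / PI - (g / PI / 2) / (INR n + 3 / 2)) (fun _ => g / PI).
    - intros n; rewrite E, S_INR; replace (2 * S n)%nat with (S (S (2 * n))) by lia.
      assert (W0 := wallis_product (S (S (2 * n)))); assert (W1 := wallis_product (S (2 * n))).
      assert (M0 := wallis_succ_le (S (S (2 * n)))); assert (M1 := wallis_succ_le (S (2 * n))).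
      assert (E1 : INR (S (2 * n)) = 2 * INR n + 1)
        by (rewrite S_INR, mult_INR; simpl (INR 2); ring).
      rewrite (S_INR (S (2 * n))), E1 in W0; rewrite E1 in W1.
      assert (Hn := pos_INR n).
      assert (Wp : 0 <= wallis (S (S (2 * n)))).
      { apply RInt_ge_0; [ lra | apply ex_RInt_sin_pow | ].
        intros t Ht; apply pow_le, sin_ge_0; lra. }
      set (w := wallis (S (S (2 * n)))) in *; set (N := INR n) in *.
      assert (Hc : 0 < 4 * g / (PI * PI)) by (apply Rdiv_lt_0_compat; nra).
      split.
      + replace (g / PI - g / PI / 2 / (N + 3 / 2))
          with (4 * g / (PI * PI) * ((N + 1) * (PI / 2 / (2 * N + 3)))) by (field; lra).
        apply Rmult_le_compat_l; [ lra | ]; apply Rmult_le_compat_l; [ lra | ].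
        assert (M := Rmult_le_compat_r w _ _ Wp M0); 
        apply Rcomplements.Rle_div_l; [ lra | ].
        apply (Rmult_le_compat_l (2 * N + 3)) in M; lra.
      + replace (g / PI) with (4 * g / (PI * PI) * ((N + 1) * (PI / 2 / (2 * N + 2))))
          by (field; lra).
        apply Rmult_le_compat_l; [ lra | ]; apply Rmult_le_compat_l; [ lra | ].
        assert (M := Rmult_le_compat_l w _ _ Wp M1).
        apply -> Rcomplements.Rle_div_r; [ | lra ].
        apply (Rmult_le_compat_l (2 * N + 2)) in M; lra.
    - evar_last.
      + apply is_lim_seq_minus'; [ apply is_lim_seq_const | apply is_lim_seq_const_div_INR_add ].
      + f_equal; ring.
    - apply is_lim_seq_const. }
  apply is_lim_seq_unique in L, L2; rewrite L in L2; injection L2 as L2.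
  apply Rmult_eq_reg_r with (/ PI); [ | apply Rinv_neq_0_compat; lra ].
  unfold Rdiv in L2; rewrite <- L2, Rinv_r; lra.
Qed.

(** * The zero-balanced series and Landen's identity *)

Definition zero_balanced_coef (a b : R) (n : nat) : R :=
  shifted_fact a n * shifted_fact b n / shifted_fact (a + b) n / INR (fact n).

Lemma hypergeom_PSeries (a b x : R) :
  hypergeom a b (a + b) x = PSeries (zero_balanced_coef a b) x.
Proof.
  apply Series_ext; intros n; unfold zero_balanced_coef, Rdiv; ring.
Qed.

Lemma zero_balanced_coef_0 (a b : R) : zero_balanced_coef a b 0 = 1.
Proof. unfold zero_balanced_coef; simpl; field. Qed.

Lemma zero_balanced_coef_pos (a b : R) (n : nat) (Ha : 0 < a) (Hb : 0 < b) :
  0 < zero_balanced_coef a b n.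
Proof.
  unfold zero_balanced_coef; repeat apply Rdiv_lt_0_compat;
    [ apply Rmult_lt_0_compat | | apply INR_fact_lt_0 ]; apply shifted_fact_pos; lra.
Qed.

Lemma zero_balanced_coef_succ (a b : R) (n : nat) (Ha : 0 < a) (Hb : 0 < b) :
  zero_balanced_coef a b (S n) =
  zero_balanced_coef a b n * ((a + INR n) * (b + INR n) / ((a + b + INR n) * (INR n + 1))).
Proof.
  unfold zero_balanced_coef; rewrite fact_simpl, mult_INR, S_INR; simpl shifted_fact.
  assert (Hn := pos_INR n); assert (Hf := INR_fact_lt_0 n).
  assert (Hs := shifted_fact_pos (a + b) n ltac:(lra)); field; lra.
Qed.

Lemma CV_radius_zero_balanced (a b : R) (Ha : 0 < a) (Hb : 0 < b) :
  CV_radius (zero_balanced_coef a b) = 1.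
Proof.
  replace (Finite 1) with (Finite (/ 1)) by (f_equal; field).
  apply CV_radius_finite_DAlembert; [ | lra | ].
  - intros n; assert (H := zero_balanced_coef_pos a b n Ha Hb); lra.
  - apply is_lim_seq_ext with
      (fun n => (1 - b / (INR n + (a + b))) * (1 + (b - 1) / (INR n + 1))).
    + intros n; assert (Hn := pos_INR n).
      assert (H := zero_balanced_coef_pos a b n Ha Hb).
      rewrite zero_balanced_coef_succ by assumption.
      rewrite Rabs_pos_eq; [ field; lra | ].
      left; apply Rdiv_lt_0_compat, H; apply Rmult_lt_0_compat; [ exact H | ].
      apply Rdiv_lt_0_compat; apply Rmult_lt_0_compat; lra.
    + evar_last.
      * apply is_lim_seq_mult'; [ apply is_lim_seq_minus' | apply is_lim_seq_plus' ];
          try apply is_lim_seq_const; apply is_lim_seq_const_div_INR_add.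
      * f_equal; ring.
Qed.

Lemma ex_series_zero_balanced (a b x : R) (Ha : 0 < a) (Hb : 0 < b) (Hx : 0 <= x < 1) :
  ex_series (fun n => zero_balanced_coef a b n * x ^ n).
Proof.
  apply ex_pseries_R, CV_radius_inside.
  rewrite CV_radius_zero_balanced, Rabs_pos_eq by lra; simpl; lra.
Qed.

Lemma Series_pos (u : nat -> R) (j : nat) (ex : ex_series u)
  (Hu : forall n, 0 <= u n) (Hj : 0 < u j) : 0 < Series u.
Proof.
  apply Rlt_le_trans with (1 := Hj).
  apply Rle_trans with (sum_n u j).
  - destruct j as [ | j ]; [ rewrite sum_O; lra | ].
    rewrite sum_Sn; change (u (S j) <= sum_n u j + u (S j)).
    enough (0 <= sum_n u j) by lra.
    clear Hj; induction j as [ | j IH ]; [ rewrite sum_O; apply Hu | ].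
    rewrite sum_Sn; apply Rplus_le_le_0_compat; [ exact IH | apply Hu ].
  - apply (is_lim_seq_incr_compare (sum_n u)).
    + apply Series_correct in ex; exact ex.
    + intros n; rewrite sum_Sn; change (sum_n u n <= sum_n u n + u (S n)).
      assert (H := Hu (S n)); lra.
Qed.

Lemma hypergeom_pos (a b x : R) (Ha : 0 < a) (Hb : 0 < b) (Hx : 0 <= x < 1) :
  0 < hypergeom a b (a + b) x.
Proof.
  rewrite hypergeom_PSeries; apply (Series_pos _ 0).
  - now apply ex_series_zero_balanced.
  - intros n; apply Rmult_le_pos; [ left; now apply zero_balanced_coef_pos | apply pow_le; lra ].
  - rewrite zero_balanced_coef_0; simpl; lra.
Qed.

(** The form in which [auto_derive] leaves derivatives of unknown functions. *)
Lemma is_derive_unique_eta (f : R -> R) (x l : R) (D : is_derive f x l) :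
  Derive (fun y => f y) x = l.
Proof. exact (is_derive_unique f x l D). Qed.

(** The hypotheses say that [x (1-x) G'' + (1-2x) G' = G/4], in self-adjoint form.
    With [p = r (1-r) / (1+r)], both [u(r) = (1+r) G(r^2)] and [v(r) = G(s(r))]
    satisfy [(p y')' = (1-r) / (1+r)^3 y], so [p (u v' - u' v)] is constant.
    It vanishes at [0] because [p] does; hence [v/u] is constant, with value [1]
    at [0]. *)
Lemma landen_of_ode (G g : R -> R)
  (dG : forall y, 0 <= y < 1 -> is_derive G y (g y))
  (dQ : forall y, 0 <= y < 1 -> is_derive (fun x => x * (1 - x) * g x) y (G y / 4))
  (G0 : forall y, 0 <= y < 1 -> 0 < G y) (r : R) (Hr : 0 < r < 1) :
  G (4 * r / (1 + r) ^ 2) = (1 + r) * G (r ^ 2).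
Proof.
  set (Q := fun x => x * (1 - x) * g x) in *.
  set (s := fun t => 4 * t / (1 + t) ^ 2).
  assert (Hs : forall t, 0 <= t < 1 -> 0 <= s t < 1).
  { intros t Ht; unfold s; split; [ apply Rdiv_le_0_compat; nra | ].
    apply Rcomplements.Rlt_div_l; nra. }
  assert (Hsq : forall t, 0 <= t < 1 -> 0 <= t ^ 2 < 1) by (intros; nra).
  set (s' := fun t => 4 * (1 - t) / (1 + t) ^ 3).
  set (G1 := fun t => G (t ^ 2)); set (G2 := fun t => G (s t)).
  set (Q1 := fun t => Q (t ^ 2)); set (Q2 := fun t => Q (s t)).
  assert (ds : forall t, 0 <= t < 1 -> is_derive s t (s' t)).
  { intros t Ht; unfold s, s'; auto_derive; [ nra | field; lra ]. }
  assert (dsq : forall t, is_derive (fun t : R => t ^ 2) t (2 * t))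
    by (intros t; auto_derive; trivial; ring).
  assert (dG1 : forall t, 0 <= t < 1 -> is_derive G1 t (2 * t * g (t ^ 2)))
    by (intros t Ht; apply (is_derive_comp G); [ apply dG, Hsq, Ht | apply dsq ]).
  assert (dQ1 : forall t, 0 <= t < 1 -> is_derive Q1 t (2 * t * (G1 t / 4)))
    by (intros t Ht; apply (is_derive_comp Q); [ apply dQ, Hsq, Ht | apply dsq ]).
  assert (dG2 : forall t, 0 <= t < 1 -> is_derive G2 t (s' t * g (s t)))
    by (intros t Ht; apply (is_derive_comp G); [ apply dG, Hs, Ht | apply ds, Ht ]).
  assert (dQ2 : forall t, 0 <= t < 1 -> is_derive Q2 t (s' t * (G2 t / 4)))
    by (intros t Ht; apply (is_derive_comp Q); [ apply dQ, Hs, Ht | apply ds, Ht ]).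
  (* The Wronskian times [p]: indeed [Q2 = p v'], and the last factor is [p u']. *)
  set (W := fun t => (1 + t) * G1 t * Q2 t
      - G2 t * (t * (1 - t) / (1 + t) * G1 t + 2 / (1 + t) * Q1 t)).
  assert (dW : forall t, 0 <= t < 1 -> is_derive W t 0).
  { intros t Ht.
    assert (D1 := dG1 t Ht); assert (D2 := dG2 t Ht).
    assert (D3 := dQ1 t Ht); assert (D4 := dQ2 t Ht).
    assert (E1 : Q1 t = t ^ 2 * (1 - t ^ 2) * g (t ^ 2)) by reflexivity.
    assert (E2 : Q2 t = s t * (1 - s t) * g (s t)) by reflexivity.
    unfold W; clearbody G1 G2 Q1 Q2; auto_derive.
    - repeat split; try (eexists; eassumption); lra.
    - rewrite (is_derive_unique_eta _ _ _ D1), (is_derive_unique_eta _ _ _ D2),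
        (is_derive_unique_eta _ _ _ D3), (is_derive_unique_eta _ _ _ D4), E1, E2.
      unfold s at 1 2, s'; generalize (g (s t)); intros; field; lra. }
  assert (W0 : forall t, 0 < t < 1 -> W t = 0).
  { intros t Ht; destruct (MVT_gen W 0 t (fun _ => 0)) as (c & _ & E).
    - rewrite Rmin_left, Rmax_right by lra; intros y Hy; apply dW; lra.
    - rewrite Rmin_left, Rmax_right by lra; intros y Hy.
      apply continuity_pt_filterlim, (ex_derive_continuous W); eexists; apply dW; lra.
    - assert (W 0 = 0); [ | lra ].
      unfold W, Q1, Q2, Q, s; replace (4 * 0 / (1 + 0) ^ 2) with 0 by field; field. }
  set (q := fun t => G2 t / ((1 + t) * G1 t)).
  assert (G1p : forall t, 0 <= t < 1 -> 0 < G1 t) by (intros; now apply G0, Hsq).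
  assert (dq : forall t, 0 < t < 1 -> is_derive q t 0).
  { intros t Ht.
    assert (D1 := dG1 t ltac:(lra)); assert (D2 := dG2 t ltac:(lra)).
    assert (P := G1p t ltac:(lra)); assert (E := W0 t Ht); unfold W in E.
    assert (E1 : Q1 t = t ^ 2 * (1 - t ^ 2) * g (t ^ 2)) by reflexivity.
    assert (E2 : Q2 t = s t * (1 - s t) * g (s t)) by reflexivity.
    rewrite E1, E2 in E; unfold s at 1 2 in E.
    unfold q; clearbody G1 G2; auto_derive.
    - repeat split; try (eexists; eassumption); nra.
    - rewrite (is_derive_unique_eta _ _ _ D1), (is_derive_unique_eta _ _ _ D2).
      unfold s'; revert E; generalize (g (s t)); intros z E.
      apply Rmult_eq_reg_l with (t * (1 - t) / (1 + t) * ((1 + t) * G1 t) ^ 2).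
      + rewrite Rmult_0_r, <- E; field; nra.
      + assert (0 < t * (1 - t) / (1 + t)) by (apply Rdiv_lt_0_compat; nra).
        assert (0 < (1 + t) * G1 t) by (apply Rmult_lt_0_compat; lra).
        apply Rgt_not_eq, Rmult_lt_0_compat; [ assumption | now apply pow_lt ]. }
  assert (dq0 : forall t, 0 <= t < 1 -> ex_derive q t).
  { intros t Ht.
    assert (D1 := dG1 t Ht); assert (D2 := dG2 t Ht); assert (P := G1p t Ht).
    unfold q; clearbody G1 G2; auto_derive; repeat split; try (eexists; eassumption); nra. }
  assert (q r = 1) as E.
  { destruct (MVT_gen q 0 r (fun _ => 0)) as (c & _ & E).
    - rewrite Rmin_left, Rmax_right by lra; intros y Hy; apply dq; lra.
    - rewrite Rmin_left, Rmax_right by lra; intros y Hy.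
      apply continuity_pt_filterlim, (ex_derive_continuous q), dq0; lra.
    - assert (q 0 = 1); [ | lra ].
      assert (P := G0 0 ltac:(lra)).
      unfold q, G1, G2, s; replace (4 * 0 / (1 + 0) ^ 2) with 0 by field.
      replace (0 ^ 2) with 0 by ring; field; lra. }
  assert (P := G1p r ltac:(lra)).
  unfold q in E; change (G2 r = (1 + r) * G1 r).
  apply (Rmult_eq_compat_r ((1 + r) * G1 r)) in E.
  rewrite Rmult_1_l in E; rewrite <- E; field; lra.
Qed.

Definition elliptic_coef : nat -> R := zero_balanced_coef (1 / 2) (1 / 2).

Lemma elliptic_coef_succ (n : nat) :
  (INR n + 1) ^ 2 * elliptic_coef (S n) = (INR n + 1 / 2) ^ 2 * elliptic_coef n.
Proof.
  unfold elliptic_coef; rewrite zero_balanced_coef_succ by lra.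
  assert (Hn := pos_INR n); field; lra.
Qed.

(** Coefficientwise the equation is the recurrence
    [(n+1)^2 c_(n+1) = (n+1/2)^2 c_n]. *)
Lemma elliptic_ode (y : R) (Hy : 0 <= y < 1) :
  is_derive (PSeries elliptic_coef) y (PSeries (PS_derive elliptic_coef) y) /\
  is_derive (fun x => x * (1 - x) * PSeries (PS_derive elliptic_coef) x) y
    (PSeries elliptic_coef y / 4).
Proof.
  assert (rad : CV_radius elliptic_coef = 1) by (apply CV_radius_zero_balanced; lra).
  set (c1 := PS_derive elliptic_coef); set (c2 := PS_derive c1).
  assert (in0 : Rbar_lt (Rabs y) (CV_radius elliptic_coef))
    by (rewrite rad, Rabs_pos_eq by lra; simpl; lra).
  assert (in1 : Rbar_lt (Rabs y) (CV_radius c1)) by (unfold c1; now rewrite CV_radius_derive).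
  assert (in2 : Rbar_lt (Rabs y) (CV_radius c2)) by (unfold c2; now rewrite CV_radius_derive).
  split; [ now apply is_derive_PSeries | ].
  assert (D := is_derive_PSeries _ _ in1); fold c2 in D.
  assert (ode : y * PSeries c2 y + PSeries c1 y =
     y * (y * PSeries c2 y + 2 * PSeries c1 y) + / 4 * PSeries elliptic_coef y).
  { assert (e0 := CV_radius_inside _ _ in0); assert (e1 := CV_radius_inside _ _ in1).
    assert (e2 := CV_radius_inside _ _ in2).
    rewrite <- (PSeries_scal 2 c1), <- (PSeries_scal (/ 4) elliptic_coef), <- (PSeries_incr_1 c2).
    assert (s1 : ex_pseries (PS_scal 2 c1) y)
      by (apply ex_pseries_scal; [ apply Rmult_comm | exact e1 ]).
    assert (s0 : ex_pseries (PS_scal (/ 4) elliptic_coef) y)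
      by (apply ex_pseries_scal; [ apply Rmult_comm | exact e0 ]).
    assert (i2 : ex_pseries (PS_incr_1 c2) y) by now apply ex_pseries_incr_1.
    rewrite <- !PSeries_plus; try assumption.
    rewrite <- PSeries_incr_1, <- PSeries_plus; try assumption.
    2:{ apply ex_pseries_incr_1; now apply ex_pseries_plus. }
    apply PSeries_ext; intros n.
    unfold PS_plus, PS_scal, PS_incr_1, c2, c1, PS_derive.
    assert (R1 := elliptic_coef_succ n).
    destruct n as [ | [ | n ] ]; unfold plus, scal, zero, mult; cbn -[INR elliptic_coef pow];
      rewrite ?S_INR in *; simpl (INR 0) in *; lra. }
  assert (E : is_derive (fun x => x * (1 - x) * PSeries c1 x) y
     ((1 - 2 * y) * PSeries c1 y + y * (1 - y) * PSeries c2 y)).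
  { revert D; generalize (PSeries c1); intros f D; auto_derive; [ now eexists; eassumption | ].
    rewrite (is_derive_unique_eta _ _ _ D); ring. }
  replace (PSeries elliptic_coef y / 4)
    with ((1 - 2 * y) * PSeries c1 y + y * (1 - y) * PSeries c2 y);
    [ exact E | lra ].
Qed.

(** Landen's (or Gauss') transformation of the complete elliptic integral. *)
Lemma landen (r : R) (Hr : 0 < r < 1) :
  hypergeom (1 / 2) (1 / 2) (1 / 2 + 1 / 2) (4 * r / (1 + r) ^ 2) =
  (1 + r) * hypergeom (1 / 2) (1 / 2) (1 / 2 + 1 / 2) (r ^ 2).
Proof.
  rewrite !hypergeom_PSeries.
  apply (landen_of_ode (PSeries elliptic_coef) (PSeries (PS_derive elliptic_coef))).
  - intros y Hy; now apply elliptic_ode.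
  - intros y Hy; now apply elliptic_ode.
  - intros y Hy; unfold elliptic_coef; rewrite <- hypergeom_PSeries; apply hypergeom_pos; lra.
  - exact Hr.
Qed.

(** * Power series with a monotone ratio of coefficients *)

Lemma minimal_nat (P : nat -> Prop) (n : nat) (Hn : P n) :
  exists k, P k /\ forall j, (j < k)%nat -> ~ P j.
Proof.
  induction n as [n IH] using lt_wf_ind.
  destruct (Classical_Prop.classic (exists j, (j < n)%nat /\ P j)) as [(j & Hj & Pj) | H].
  - exact (IH j Hj Pj).
  - exists n; split; [ exact Hn | ]; intros j Hj Pj; apply H; now exists j.
Qed.

Lemma pow_antitone (t : R) (m n : nat) (Ht : 0 <= t <= 1) (Hmn : (m <= n)%nat) : t ^ n <= t ^ m.
Proof.
  replace n with (m + (n - m))%nat by lia; rewrite pow_add.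
  rewrite <- (Rmult_1_r (t ^ m)) at 2.
  apply Rmult_le_compat_l; [ apply pow_le; lra | ].
  rewrite <- (pow1 (n - m)); now apply pow_incr.
Qed.

Lemma ratio_antitone (U V : nat -> R)
  (V_pos : forall n, 0 < V n)
  (ratio_le : forall n, U (S n) * V n <= U n * V (S n))
  (m n : nat) (Hmn : (m <= n)%nat) : U n / V n <= U m / V m.
Proof.
  induction Hmn as [ | n Hmn IH ]; [ lra | ].
  apply Rle_trans with (2 := IH).
  assert (H := ratio_le n); assert (H1 := V_pos n); assert (H2 := V_pos (S n)).
  apply Rcomplements.Rle_div_l; [ exact H2 | ].
  replace (U n / V n * V (S n)) with (U n * V (S n) / V n) by (field; lra).
  now apply Rcomplements.Rle_div_r.
Qed.

(** Let [rho] be the quotient of the sums at [y].  The coefficients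
    [e n = U n - rho * V n] change sign at most once, from positive to negative,
    say at [k].  Passing from [y] to [x < y] multiplies the [n]-th term by
    [(x/y)^n], which is at least [(x/y)^k] for the positive terms and at most
    [(x/y)^k] for the negative ones.  The sum vanishes at [y], so it is positive
    at [x]. *)
Lemma PSeries_ratio_lt (U V : nat -> R)
  (V_pos : forall n, 0 < V n)
  (ratio_le : forall n, U (S n) * V n <= U n * V (S n))
  (ratio_lt : U 2%nat * V 1%nat < U 1%nat * V 2%nat) (x y : R) (Hx : 0 < x) (Hxy : x < y)
  (exU : forall z, 0 < z <= y -> ex_series (fun n => U n * z ^ n))
  (exV : forall z, 0 < z <= y -> ex_series (fun n => V n * z ^ n)) :
  PSeries U y * PSeries V x < PSeries U x * PSeries V y.
Proof.
  assert (Gp : forall z, 0 < z <= y -> 0 < PSeries V z).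
  { intros z Hz; apply (Series_pos _ 0); [ now apply exV | | ].
    - intros n; left; apply Rmult_lt_0_compat; [ apply V_pos | apply pow_lt; lra ].
    - simpl; rewrite Rmult_1_r; apply V_pos. }
  assert (Gy := Gp y ltac:(lra)).
  set (rho := PSeries U y / PSeries V y).
  set (e := fun n => U n - rho * V n).
  assert (exe : forall z, 0 < z <= y -> ex_series (fun n => e n * z ^ n)).
  { intros z Hz.
    apply ex_series_ext with (fun n => minus (U n * z ^ n) (rho * (V n * z ^ n))).
    - intros n; unfold e, minus, plus, opp; simpl; ring.
    - apply (ex_series_minus (fun n => U n * z ^ n)); [ now apply exU | ].
      now apply (ex_series_scal_l rho (fun n => V n * z ^ n)), exV. }
  assert (Se : forall z, 0 < z <= y ->
            Series (fun n => e n * z ^ n) = PSeries U z - rho * PSeries V z).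
  { intros z Hz; unfold PSeries; rewrite <- Series_scal_l, <- Series_minus.
    - apply Series_ext; intros n; unfold e; ring.
    - now apply exU.
    - now apply (ex_series_scal_l rho (fun n => V n * z ^ n)), exV. }
  assert (Se0 : Series (fun n => e n * y ^ n) = 0).
  { rewrite Se by lra; unfold rho; field; lra. }
  assert (e_sign : forall n, e n <= 0 <-> U n / V n <= rho).
  { intros n; assert (H := V_pos n); unfold e; split; intros Hle;
      [ apply <- Rcomplements.Rle_div_l | apply -> Rcomplements.Rle_div_l in Hle ]; lra. }
  enough (P : 0 < Series (fun n => e n * x ^ n)).
  { rewrite Se in P by lra; unfold rho in P.
    apply (Rmult_lt_compat_r (PSeries V y)) in P; [ | exact Gy ].
    replace ((PSeries U x - _) * _)
      with (PSeries U x * PSeries V y - PSeries U y * PSeries V x) in P by (field; lra).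
    lra. }
  destruct (Classical_Prop.classic (exists n, e n <= 0)) as [[n Hn] | H].
  2:{ assert (ep : forall n, 0 < e n)
        by (intros n; apply Rnot_le_lt; intros Hn; apply H; now exists n).
      apply (Series_pos _ 0); [ apply exe; lra | | ].
      - intros n; left; apply Rmult_lt_0_compat; [ apply ep | now apply pow_lt ].
      - simpl; rewrite Rmult_1_r; apply ep. }
  destruct (minimal_nat (fun n => e n <= 0) n Hn) as (k & Hk & kmin); clear n Hn.
  set (t := x / y).
  assert (Ht : 0 < t < 1).
  { split; [ apply Rdiv_lt_0_compat | apply Rcomplements.Rlt_div_l ]; lra. }
  assert (xt : forall n, x ^ n = t ^ n * y ^ n).
  { intros n; rewrite <- Rpow_mult_distr; f_equal; unfold t; field; lra. }
  set (d := fun n => e n * x ^ n - t ^ k * (e n * y ^ n)).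
  assert (dE : forall n, d n = e n * (t ^ n - t ^ k) * y ^ n)
    by (intros n; unfold d; rewrite xt; ring).
  assert (exd : ex_series d).
  { apply (ex_series_minus (fun n => e n * x ^ n)); [ apply exe; lra | ].
    apply (ex_series_scal_l (t ^ k) (fun n => e n * y ^ n)), exe; lra. }
  assert (Sd : Series d = Series (fun n => e n * x ^ n)).
  { unfold d; rewrite Series_minus, Series_scal_l, Se0; [ ring | apply exe; lra | ].
    apply (ex_series_scal_l (t ^ k) (fun n => e n * y ^ n)), exe; lra. }
  rewrite <- Sd.
  assert (e_neg : forall n, (k <= n)%nat -> e n <= 0).
  { intros n Hkn; apply e_sign.
    apply Rle_trans with (1 := ratio_antitone U V V_pos ratio_le k n Hkn); now apply e_sign. }
  assert (yp : forall n, 0 < y ^ n) by (intros; apply pow_lt; lra).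
  assert (d0 : forall n, 0 <= d n).
  { intros n; rewrite dE; apply Rmult_le_pos; [ | left; apply yp ].
    destruct (Nat.lt_ge_cases n k) as [Hnk | Hkn].
    - assert (t ^ k <= t ^ n) by (apply pow_antitone; [ lra | lia ]).
      assert (0 < e n) by (apply Rnot_le_lt, kmin, Hnk); nra.
    - assert (t ^ n <= t ^ k) by (apply pow_antitone; [ lra | lia ]).
      assert (Hen := e_neg n Hkn); nra. }
  (* A strictly positive term: [n = 2] if all coefficients are nonpositive, since
     the ratio drops between [1] and [2]; otherwise [n = 0]. *)
  destruct k as [ | k ].
  - apply (Series_pos d 2 exd d0).
    rewrite dE; apply Rmult_lt_0_compat; [ | apply yp ].
    assert (e 2%nat < 0).
    { assert (E1 := e_neg 1%nat ltac:(lia)).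
      assert (v1 := V_pos 1%nat); assert (v2 := V_pos 2%nat).
      unfold e in *; apply Rlt_minus, Rmult_lt_reg_r with (1 := v1).
      apply Rlt_le_trans with (1 := ratio_lt).
      replace (rho * V 2%nat * V 1%nat) with (rho * V 1%nat * V 2%nat) by ring.
      apply Rmult_le_compat_r; lra. }
    assert (t ^ 2 < 1) by (simpl; nra); rewrite pow_O.
    revert H; generalize (e 2%nat); intros w Hw; nra.
  - apply (Series_pos d 0 exd d0).
    rewrite dE; apply Rmult_lt_0_compat; [ | apply yp ].
    assert (0 < e 0%nat) by (apply Rnot_le_lt, kmin; lia).
    assert (t ^ S k < 1).
    { apply Rle_lt_trans with (t ^ 1); [ apply pow_antitone; [ lra | lia ] | lra ]. }
    rewrite pow_O; apply Rmult_lt_0_compat; lra.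
Qed.

(** The ratio decreases to its limit [1]. *)
Lemma ratio_ge_1 (U V : nat -> R)
  (V_pos : forall n, 0 < V n)
  (ratio_le : forall n, U (S n) * V n <= U n * V (S n))
  (U_lim : is_lim_seq (fun n => INR n * U n) 1)
  (V_lim : is_lim_seq (fun n => INR n * V n) 1)
  (n : nat) : V n <= U n.
Proof.
  assert (L : is_lim_seq (fun m => U m / V m) 1).
  { apply is_lim_seq_incr_1.
    apply is_lim_seq_ext with (fun m => (INR (S m) * U (S m)) / (INR (S m) * V (S m))).
    - intros m; assert (H := V_pos (S m)).
      assert (0 < INR (S m)) by (apply lt_0_INR; lia); field; lra.
    - replace (Finite 1) with (Finite (1 / 1)) by (f_equal; field).
      apply is_lim_seq_div'; [ | | lra ].
      + now apply (is_lim_seq_incr_1 (fun m => INR m * U m)).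
      + now apply (is_lim_seq_incr_1 (fun m => INR m * V m)). }
  assert (H : 1 <= U n / V n).
  { apply (is_lim_seq_decr_compare (fun m => U m / V m) 1 L).
    intros m; apply ratio_antitone; [ assumption .. | lia ]. }
  apply Rcomplements.Rle_div_r in H; [ lra | apply V_pos ].
Qed.

Lemma ratio_gt_1 (U V : nat -> R)
  (V_pos : forall n, 0 < V n)
  (ratio_le : forall n, U (S n) * V n <= U n * V (S n))
  (U_lim : is_lim_seq (fun n => INR n * U n) 1)
  (V_lim : is_lim_seq (fun n => INR n * V n) 1)
  (ratio_lt : U 2%nat * V 1%nat < U 1%nat * V 2%nat) : V 1%nat < U 1%nat.
Proof.
  assert (H := ratio_ge_1 U V V_pos ratio_le U_lim V_lim 2%nat).
  assert (V1 := V_pos 1%nat); assert (V2 := V_pos 2%nat); nra.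
Qed.

Lemma PSeries_lt (U V : nat -> R) (y : R) (Hy : 0 < y)
  (exU : ex_series (fun n => U n * y ^ n)) (exV : ex_series (fun n => V n * y ^ n))
  (HUV : forall n, V n <= U n) (H1 : V 1%nat < U 1%nat) : PSeries V y < PSeries U y.
Proof.
  apply -> Rlt_0_minus; unfold PSeries; rewrite <- Series_minus by assumption.
  assert (yp : forall n, 0 < y ^ n) by (intros; now apply pow_lt).
  apply (Series_pos _ 1).
  - now apply (ex_series_minus (fun n => U n * y ^ n)).
  - intros n; assert (H := HUV n); assert (P := yp n); nra.
  - assert (P := yp 1%nat); nra.
Qed.

Lemma PSeries_normalized_le (U V : nat -> R) (y : R)
  (U_pos : forall n, 0 < U n) (V_pos : forall n, 0 < V n)
  (ratio_le : forall n, U (S n) * V n <= U n * V (S n)) (Hy : 0 <= y)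
  (exV : ex_series (fun n => V n * y ^ n)) :
  V 0%nat * PSeries U y <= U 0%nat * PSeries V y.
Proof.
  unfold PSeries; rewrite <- !Series_scal_l; apply Series_le.
  - intros n; assert (yp : 0 <= y ^ n) by now apply pow_le.
    assert (v0 := V_pos 0%nat); assert (vn := V_pos n); assert (un := U_pos n).
    rewrite <- !Rmult_assoc; split.
    + apply Rmult_le_pos; [ nra | exact yp ].
    + apply Rmult_le_compat_r; [ exact yp | ].
      assert (H := ratio_antitone U V V_pos ratio_le 0 n ltac:(lia)).
      apply (Rmult_le_compat_r (V 0%nat * V n)) in H; [ | nra ].
      replace (U n / V n * (V 0%nat * V n)) with (V 0%nat * U n) in H by (field; lra).
      replace (U 0%nat / V 0%nat * (V 0%nat * V n)) with (U 0%nat * V n) in H by (field; lra).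
      exact H.
  - now apply (ex_series_scal_l (U 0%nat) (fun n => V n * y ^ n)).
Qed.

Lemma PSeries_nonneg_mono (D : nat -> R) (L y z : R) (D0 : forall n, 0 <= D n)
  (HL : is_series D L) (Hy : 0 <= y) (Hyz : y <= z) (Hz : z <= 1) :
  0 <= PSeries D y /\ PSeries D y <= PSeries D z /\ PSeries D z <= L.
Proof.
  assert (dom : forall t n, 0 <= t <= 1 -> 0 <= D n * t ^ n <= D n).
  { intros t n Ht; assert (H := D0 n).
    assert (0 <= t ^ n) by (apply pow_le; lra).
    assert (t ^ n <= t ^ 0) by (apply pow_antitone; [ lra | lia ]); simpl in *; nra. }
  assert (ex : forall t, 0 <= t <= 1 -> ex_series (fun n => D n * t ^ n)).
  { intros t Ht; apply (ex_series_le (V := R_CompleteNormedModule) _ D); [ | now exists L ].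
    intros n; change (Rabs (D n * t ^ n) <= D n).
    rewrite Rabs_pos_eq; now apply dom. }
  unfold PSeries; repeat split.
  - replace 0 with (Series (fun _ : nat => 0)) by (apply is_series_unique;
      apply is_series_ext with (fun n => scal 0 (D n)); [ intros; apply Rmult_0_l | 
      evar_last; [ apply (is_series_scal_l 0 D L HL) | apply Rmult_0_l ] ]).
    apply Series_le; [ | apply ex; lra ]; intros n; split; [ lra | apply dom; lra ].
  - apply Series_le; [ | apply ex; lra ]; intros n; split; [ apply dom; lra | ].
    apply Rmult_le_compat_l; [ apply D0 | apply pow_incr; lra ].
  - rewrite <- (is_series_unique D L HL).
    apply Series_le; [ intros n; apply dom; lra | now exists L ].
Qed.

(** By monotonicity the left side is at most [r * PSeries D (r ^ 2)]. *)
Lemma landen_defect_le (D : nat -> R) (L r s : R) (D0 : forall n, 0 <= D n)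
  (HL : is_series D L) (Hr : 0 < r < 1) (Hrs : r ^ 2 <= s) (Hs : s <= 1) :
  (1 + r) * PSeries D (r ^ 2) - PSeries D s <= L.
Proof.
  destruct (PSeries_nonneg_mono D L (r ^ 2) s D0 HL) as (H1 & H2 & H3); try nra.
Qed.

(** * Comparison with the elliptic case *)

Lemma Beta_pos (a b : R) (Ha : 0 < a) (Hb : 0 < b) : 0 < Beta a b.
Proof.
  apply Rdiv_lt_0_compat; [ apply Rmult_lt_0_compat | ]; apply Gamma_pos; lra.
Qed.

Lemma gamma_term_Beta (a b : R) (n : nat) (Ha : 0 < a) (Hb : 0 < b) :
  gamma_term a b n = Beta a b * zero_balanced_coef a b n.
Proof.
  unfold gamma_term, Beta, zero_balanced_coef; rewrite !Gamma_shifted_fact by lra.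
  assert (Hs := shifted_fact_pos (a + b) n ltac:(lra)); assert (Hf := INR_fact_lt_0 n).
  assert (Hg := Gamma_pos (a + b) ltac:(lra)); field; lra.
Qed.

Lemma PSeries_gamma_term (a b x : R) (Ha : 0 < a) (Hb : 0 < b) :
  PSeries (gamma_term a b) x = Beta a b * hypergeom a b (a + b) x.
Proof.
  rewrite hypergeom_PSeries, <- PSeries_scal; apply PSeries_ext; intros n.
  now apply gamma_term_Beta.
Qed.

Lemma ex_series_gamma_term (a b x : R) (Ha : 0 < a) (Hb : 0 < b) (Hx : 0 <= x < 1) :
  ex_series (fun n => gamma_term a b n * x ^ n).
Proof.
  apply ex_series_ext with (fun n => Beta a b * (zero_balanced_coef a b n * x ^ n)).
  - intros n; rewrite gamma_term_Beta by assumption; symmetry; apply Rmult_assoc.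
  - apply (ex_series_scal_l (Beta a b) (fun n => zero_balanced_coef a b n * x ^ n)).
    now apply ex_series_zero_balanced.
Qed.

Lemma Beta_half : Beta (1 / 2) (1 / 2) = PI.
Proof.
  unfold Beta; rewrite Gamma_half_sqr; replace (1 / 2 + 1 / 2) with 1 by field.
  rewrite Gamma_1; field.
Qed.

(** Cross-multiplying, the sign is that of
    [(a+n) (b+n) (n+1) - (n+1/2)^2 (a+b+n)], whose terms of degree [2] and [3]
    in [n] cancel. *)
Lemma gamma_term_cross (a b : R) (n : nat) (Ha : 0 < a) (Hb : 0 < b) :
  exists w, 0 < w /\
    gamma_term a b (S n) * gamma_term (1 / 2) (1 / 2) n
      - gamma_term a b n * gamma_term (1 / 2) (1 / 2) (S n) =
    w * ((a * b - 1 / 4) * INR n + (a * b - (a + b) / 4)).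
Proof.
  assert (Hn := pos_INR n).
  exists (gamma_term a b n * gamma_term (1 / 2) (1 / 2) n /
            ((a + b + INR n) * (INR n + 1) ^ 2)); split.
  - apply Rdiv_lt_0_compat; apply Rmult_lt_0_compat; try apply gamma_term_pos; try lra.
    apply pow_lt; lra.
  - rewrite !gamma_term_succ by lra; field; lra.
Qed.

Lemma Rfun_sub_ln16 (a b : R) : Rfun a b - ln 16 = (Psi (1 / 2) - Psi a) + (Psi (1 / 2) - Psi b).
Proof.
  assert (E : ln 16 = 4 * ln 2).
  { replace 16 with (2 ^ 4) by ring; rewrite ln_pow by lra.
    f_equal; simpl; ring. }
  unfold Rfun; rewrite Psi_half, E; ring.
Qed.

(** If [4ab > a+b] while [4ab <= 1], then [a+b < 1], and so
    [4ab <= (a+b)^2 <= a+b], a contradiction. *)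
Lemma D1_coef (a b : R) (H : D1 a b) : a * b - 1 / 4 <= 0 /\ a * b - (a + b) / 4 <= 0.
Proof.
  destruct H as (Ha & Hb & H); split; [ lra | ].
  apply Rnot_lt_le; intros Hlt.
  assert (0 <= (a - b) ^ 2) by apply pow2_ge_0.
  assert (a + b < 1) by lra.
  nra.
Qed.

(** From [a+b <= 4ab <= (a+b)^2] follows [1 <= a+b]. *)
Lemma D2_coef (a b : R) (H : D2 a b) : 0 <= a * b - 1 / 4 /\ 0 <= a * b - (a + b) / 4.
Proof.
  destruct H as (Ha & Hb & H).
  assert (Hs : a + b <= 4 * (a * b)).
  { replace (1 / a + 1 / b) with ((a + b) / (a * b)) in H by (field; lra).
    apply -> Rcomplements.Rle_div_l in H; [ exact H | now apply Rmult_lt_0_compat ]. }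
  assert (0 <= (a - b) ^ 2) by apply pow2_ge_0.
  assert (1 <= a + b) by nra.
  split; lra.
Qed.

Lemma coef_eq_half (a b : R) (H1 : a * b = 1 / 4) (H2 : a + b = 1) : (a, b) = (1 / 2, 1 / 2).
Proof.
  assert (a - 1 / 2 = 0) by (apply Rsqr_0_uniq; unfold Rsqr; nra).
  f_equal; lra.
Qed.


(** The value at [1] of [B F - PI G]: the logarithmic singularities cancel and the
    difference of the constant terms remains. *)
Lemma is_series_gamma_term_sub_half (a b : R) (Ha : 0 < a) (Hb : 0 < b) :
  is_series (fun n => gamma_term a b n - gamma_term (1 / 2) (1 / 2) n) (Rfun a b - ln 16).
Proof.
  rewrite Rfun_sub_ln16.
  assert (L := sum_n_gamma_term_sub_lim a b (1 / 2) (1 / 2) Ha Hb ltac:(lra) ltac:(lra)).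
  refine (is_lim_seq_ext _ _ _ _ L); intros N.
  induction N as [ | N IH ]; [ now rewrite !sum_O | ].
  rewrite !sum_Sn, <- IH; unfold plus; simpl AbelianMonoid.plus.
  lazymatch goal with |- ?u = ?v => change (@eq R u v) end; ring.
Qed.

Lemma landen_argument_bounds (r : R) (Hr : 0 < r < 1) : r ^ 2 < 4 * r / (1 + r) ^ 2 < 1.
Proof.
  assert (0 < (1 + r) ^ 2) by (apply pow_lt; lra).
  split; [ apply -> Rcomplements.Rlt_div_r; [ | assumption ] | apply Rcomplements.Rlt_div_l; nra ].
  assert (r * (1 + r) ^ 2 < 4) by nra; nra.
Qed.

Lemma gamma_term_half_pos (n : nat) : 0 < gamma_term (1 / 2) (1 / 2) n.
Proof. apply gamma_term_pos; lra. Qed.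

Lemma ratio_le_D1 (a b : R) (H : D1 a b) (n : nat) :
  gamma_term a b (S n) * gamma_term (1 / 2) (1 / 2) n <=
  gamma_term a b n * gamma_term (1 / 2) (1 / 2) (S n).
Proof.
  assert (Ha : 0 < a) by apply H; assert (Hb : 0 < b) by apply H.
  destruct (D1_coef a b H) as [H1 H2].
  destruct (gamma_term_cross a b n Ha Hb) as (w & Hw & E); assert (Hn := pos_INR n).
  assert ((a * b - 1 / 4) * INR n + (a * b - (a + b) / 4) <= 0) by nra; nra.
Qed.

Lemma ratio_le_D2 (a b : R) (H : D2 a b) (n : nat) :
  gamma_term (1 / 2) (1 / 2) (S n) * gamma_term a b n <=
  gamma_term (1 / 2) (1 / 2) n * gamma_term a b (S n).
Proof.
  assert (Ha : 0 < a) by apply H; assert (Hb : 0 < b) by apply H.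
  destruct (D2_coef a b H) as [H1 H2].
  destruct (gamma_term_cross a b n Ha Hb) as (w & Hw & E); assert (Hn := pos_INR n).
  assert (0 <= (a * b - 1 / 4) * INR n + (a * b - (a + b) / 4)) by nra; nra.
Qed.

Lemma ratio_lt_D1 (a b : R) (H : D1 a b) (Hne : (a, b) <> (1 / 2, 1 / 2)) :
  gamma_term a b 2 * gamma_term (1 / 2) (1 / 2) 1 <
  gamma_term a b 1 * gamma_term (1 / 2) (1 / 2) 2.
Proof.
  assert (Ha : 0 < a) by apply H; assert (Hb : 0 < b) by apply H.
  destruct (D1_coef a b H) as [H1 H2].
  destruct (gamma_term_cross a b 1 Ha Hb) as (w & Hw & E); simpl (INR 1) in E.
  assert ((a * b - 1 / 4) * 1 + (a * b - (a + b) / 4) < 0); [ | nra ].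
  apply Rnot_le_lt; intros Hle; apply Hne, coef_eq_half; lra.
Qed.

Lemma ratio_lt_D2 (a b : R) (H : D2 a b) (Hne : (a, b) <> (1 / 2, 1 / 2)) :
  gamma_term (1 / 2) (1 / 2) 2 * gamma_term a b 1 <
  gamma_term (1 / 2) (1 / 2) 1 * gamma_term a b 2.
Proof.
  assert (Ha : 0 < a) by apply H; assert (Hb : 0 < b) by apply H.
  destruct (D2_coef a b H) as [H1 H2].
  destruct (gamma_term_cross a b 1 Ha Hb) as (w & Hw & E); simpl (INR 1) in E.
  assert (0 < (a * b - 1 / 4) * 1 + (a * b - (a + b) / 4)); [ | nra ].
  apply Rnot_le_lt; intros Hle; apply Hne, coef_eq_half; lra.
Qed.

Lemma gamma_term_0 (a b : R) (Ha : 0 < a) (Hb : 0 < b) : gamma_term a b 0 = Beta a b.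
Proof. rewrite gamma_term_Beta, zero_balanced_coef_0 by assumption; ring. Qed.

Lemma PSeries_gamma_term_half (x : R) :
  PSeries (gamma_term (1 / 2) (1 / 2)) x = PI * hypergeom (1 / 2) (1 / 2) (1 / 2 + 1 / 2) x.
Proof. rewrite PSeries_gamma_term, Beta_half by lra; reflexivity. Qed.

(** What the monotone ratio of coefficients says about the functions.  The order
    of [F] and [F'] depends on the normalisation: [F <= F'] when both have first
    coefficient [1], and the opposite when both have coefficients asymptotic to
    [1/n]. *)
Lemma zero_balanced_comparison (a b a' b' y z : R)
  (Ha : 0 < a) (Hb : 0 < b) (Ha' : 0 < a') (Hb' : 0 < b')
  (ratio_le : forall n, gamma_term a b (S n) * gamma_term a' b' n <=
                        gamma_term a b n * gamma_term a' b' (S n))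
  (ratio_lt : gamma_term a b 2 * gamma_term a' b' 1 < gamma_term a b 1 * gamma_term a' b' 2)
  (Hy : 0 < y) (Hyz : y < z) (Hz : z < 1) :
  let F := hypergeom a b (a + b) in
  let F' := hypergeom a' b' (a' + b') in
  F z * F' y < F y * F' z /\ Beta a' b' * F' z < Beta a b * F z /\ F y <= F' y.
Proof.
  intros F F'; set (U := gamma_term a b) in *; set (V := gamma_term a' b') in *.
  assert (U_pos : forall n, 0 < U n) by (intros; now apply gamma_term_pos).
  assert (V_pos : forall n, 0 < V n) by (intros; now apply gamma_term_pos).
  assert (exU : forall t, 0 < t <= z -> ex_series (fun n => U n * t ^ n))
    by (intros; apply ex_series_gamma_term; lra).
  assert (exV : forall t, 0 < t <= z -> ex_series (fun n => V n * t ^ n))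
    by (intros; apply ex_series_gamma_term; lra).
  assert (U_lim := is_lim_seq_INR_mul_gamma_term a b Ha Hb).
  assert (V_lim := is_lim_seq_INR_mul_gamma_term a' b' Ha' Hb').
  assert (C1 := PSeries_ratio_lt U V V_pos ratio_le ratio_lt y z Hy Hyz exU exV).
  assert (C2 := PSeries_lt U V z ltac:(lra) (exU z ltac:(lra)) (exV z ltac:(lra))
    (ratio_ge_1 U V V_pos ratio_le U_lim V_lim)
    (ratio_gt_1 U V V_pos ratio_le U_lim V_lim ratio_lt)).
  assert (C3 := PSeries_normalized_le U V y U_pos V_pos ratio_le ltac:(lra)
    (exV y ltac:(lra))).
  unfold U, V in C1, C2, C3; rewrite !gamma_term_0 in C3 by assumption.
  repeat rewrite PSeries_gamma_term in C1 by assumption.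
  rewrite !PSeries_gamma_term in C2, C3 by assumption.
  fold F F' in C1, C2, C3.
  assert (Bp := Beta_pos a b Ha Hb); assert (Bp' := Beta_pos a' b' Ha' Hb').
  assert (BB : 0 < Beta a b * Beta a' b') by now apply Rmult_lt_0_compat.
  split; [ | split; [ exact C2 | ] ].
  - apply Rmult_lt_reg_l with (1 := BB); lra.
  - apply Rmult_le_reg_l with (1 := BB); lra.
Qed.

Lemma landen_strict_D1 (a b r : R) (H : D1 a b) (Hne : (a, b) <> (1 / 2, 1 / 2)) (Hr : 0 < r < 1) :
  let F := hypergeom a b (a + b) in
  F (4 * r / (1 + r) ^ 2) < (1 + r) * F (r ^ 2) /\
  PI * ((1 + r) * F (r ^ 2)) < Beta a b * F (4 * r / (1 + r) ^ 2).
Proof.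
  assert (Ha : 0 < a) by apply H; assert (Hb : 0 < b) by apply H; intros F.
  assert (Hs := landen_argument_bounds r Hr); assert (Hr2 : 0 < r ^ 2) by (apply pow_lt; lra).
  destruct (zero_balanced_comparison a b (1 / 2) (1 / 2) (r ^ 2) (4 * r / (1 + r) ^ 2))
    as (C1 & C2 & C3); try lra; [ now apply ratio_le_D1 | now apply ratio_lt_D1 | ].
  rewrite Beta_half in C2; rewrite landen in C1, C2 by exact Hr; fold F in C1, C2, C3.
  assert (Gp := hypergeom_pos (1 / 2) (1 / 2) (r ^ 2) ltac:(lra) ltac:(lra) ltac:(lra)).
  split.
  - apply Rmult_lt_reg_r with (1 := Gp); lra.
  - apply Rle_lt_trans with (2 := C2).
    apply Rmult_le_compat_l; [ left; apply PI_RGT_0 | apply Rmult_le_compat_l; lra ].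
Qed.

Lemma landen_strict_D2 (a b r : R) (H : D2 a b) (Hne : (a, b) <> (1 / 2, 1 / 2)) (Hr : 0 < r < 1) :
  let F := hypergeom a b (a + b) in
  (1 + r) * F (r ^ 2) < F (4 * r / (1 + r) ^ 2) /\
  Beta a b * F (4 * r / (1 + r) ^ 2) < PI * ((1 + r) * F (r ^ 2)).
Proof.
  assert (Ha : 0 < a) by apply H; assert (Hb : 0 < b) by apply H; intros F.
  assert (Hs := landen_argument_bounds r Hr); assert (Hr2 : 0 < r ^ 2) by (apply pow_lt; lra).
  destruct (zero_balanced_comparison (1 / 2) (1 / 2) a b (r ^ 2) (4 * r / (1 + r) ^ 2))
    as (C1 & C2 & C3); try lra; [ now apply ratio_le_D2 | now apply ratio_lt_D2 | ].
  rewrite Beta_half in C2; rewrite landen in C1, C2 by exact Hr; fold F in C1, C2, C3.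
  assert (Gp := hypergeom_pos (1 / 2) (1 / 2) (r ^ 2) ltac:(lra) ltac:(lra) ltac:(lra)).
  split.
  - apply Rmult_lt_reg_l with (1 := Gp); lra.
  - apply Rlt_le_trans with (1 := C2).
    apply Rmult_le_compat_l; [ left; apply PI_RGT_0 | apply Rmult_le_compat_l; lra ].
Qed.

Lemma gamma_term_half_le_D1 (a b : R) (H : D1 a b) (n : nat) :
  gamma_term (1 / 2) (1 / 2) n <= gamma_term a b n.
Proof.
  apply ratio_ge_1; [ apply gamma_term_half_pos | now apply ratio_le_D1 | .. ];
    apply is_lim_seq_INR_mul_gamma_term; solve [ apply H | lra ].
Qed.

Lemma gamma_term_le_half_D2 (a b : R) (H : D2 a b) (n : nat) :
  gamma_term a b n <= gamma_term (1 / 2) (1 / 2) n.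
Proof.
  apply ratio_ge_1; [ intros m; apply gamma_term_pos; apply H | now apply ratio_le_D2 | .. ];
    apply is_lim_seq_INR_mul_gamma_term; solve [ apply H | lra ].
Qed.

Lemma PSeries_gamma_term_sub_half (a b x : R) (Ha : 0 < a) (Hb : 0 < b) (Hx : 0 <= x < 1) :
  PSeries (fun n => gamma_term a b n - gamma_term (1 / 2) (1 / 2) n) x =
  Beta a b * hypergeom a b (a + b) x - PI * hypergeom (1 / 2) (1 / 2) (1 / 2 + 1 / 2) x.
Proof.
  rewrite <- PSeries_gamma_term_half, <- PSeries_gamma_term by assumption.
  unfold PSeries; rewrite <- Series_minus by (apply ex_series_gamma_term; lra).
  apply Series_ext; intros n; ring.
Qed.

Lemma landen_defect_D1 (a b r : R) (H : D1 a b) (Hr : 0 < r < 1) :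
  let F := hypergeom a b (a + b) in
  (1 + r) * F (r ^ 2) - F (4 * r / (1 + r) ^ 2) <= (Rfun a b - ln 16) / Beta a b.
Proof.
  assert (Ha : 0 < a) by apply H; assert (Hb : 0 < b) by apply H; intros F.
  assert (Hs := landen_argument_bounds r Hr); assert (L := landen r Hr).
  set (s := 4 * r / (1 + r) ^ 2) in *; assert (Hr2 := pow2_ge_0 r).
  apply -> Rcomplements.Rle_div_r; [ | now apply Beta_pos ].
  assert (K := landen_defect_le (fun n => gamma_term a b n - gamma_term (1 / 2) (1 / 2) n)
    (Rfun a b - ln 16) r s).
  rewrite !PSeries_gamma_term_sub_half, L in K by lra; fold F in K.
  refine (Rle_trans _ _ _ _ (K _ _ Hr _ _)); try lra.
  - intros n; assert (E := gamma_term_half_le_D1 a b H n); lra.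
  - now apply is_series_gamma_term_sub_half.
Qed.

Lemma landen_defect_D2 (a b r : R) (H : D2 a b) (Hr : 0 < r < 1) :
  let F := hypergeom a b (a + b) in
  F (4 * r / (1 + r) ^ 2) - (1 + r) * F (r ^ 2) <= (ln 16 - Rfun a b) / Beta a b.
Proof.
  assert (Ha : 0 < a) by apply H; assert (Hb : 0 < b) by apply H; intros F.
  assert (Hs := landen_argument_bounds r Hr); assert (L := landen r Hr).
  set (s := 4 * r / (1 + r) ^ 2) in *; assert (Hr2 := pow2_ge_0 r).
  apply -> Rcomplements.Rle_div_r; [ | now apply Beta_pos ].
  set (d := fun n => gamma_term a b n - gamma_term (1 / 2) (1 / 2) n).
  assert (K := landen_defect_le (fun n => - d n) (ln 16 - Rfun a b) r s).
  assert (opp : forall x, PSeries (fun n => - d n) x = - PSeries d x)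
    by (intros; apply (PSeries_opp d)).
  rewrite !opp in K; unfold d in K at 3 4.
  rewrite !PSeries_gamma_term_sub_half, L in K by lra; fold F in K.
  refine (Rle_trans _ _ _ _ (K _ _ Hr _ _)); try lra.
  - intros n; unfold d; assert (E := gamma_term_le_half_D2 a b H n); lra.
  - replace (ln 16 - Rfun a b) with (- (Rfun a b - ln 16)) by ring.
    exact (is_series_opp d _ (is_series_gamma_term_sub_half a b Ha Hb)).
Qed.

Theorem theorem2p5 (a b x : R) (Ha : 0 < a) (Hb : 0 < b) (Hx : 0 < x < 1) :
  let F := hypergeom a b (a + b) in
  let B := Beta a b in
  let R0 := Rfun a b in
  (D1 a b -> (a, b) <> (1 / 2, 1 / 2) ->
     1 / 2 < F (((1 - x) / (1 + x)) ^ 2) / ((1 + x) * F (1 - x ^ 2))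
           < B / (2 * PI))
  /\
  (D3 a b ->
     (1 + x) * F (1 - x ^ 2)
       <= 2 * F (((1 - x) / (1 + x)) ^ 2)
       <= (1 + x) * (F (1 - x ^ 2) + (R0 - ln 16) / B))
  /\
  ((D2 a b -> (a, b) <> (1 / 2, 1 / 2) ->
      B / (2 * PI) < F (((1 - x) / (1 + x)) ^ 2) / ((1 + x) * F (1 - x ^ 2))
                   < 1 / 2)
   /\
   (D2 a b ->
      0 <= (1 + x) * F (1 - x ^ 2) - 2 * F (((1 - x) / (1 + x)) ^ 2)
        <= (1 + x) * (ln 16 - R0) / B)).
Proof.
  intros F B R0; set (r := (1 - x) / (1 + x)).
  assert (Hr : 0 < r < 1).
  { unfold r; split; [ apply Rdiv_lt_0_compat | apply Rcomplements.Rlt_div_l ]; lra. }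
  assert (Hs : 4 * r / (1 + r) ^ 2 = 1 - x ^ 2) by (unfold r; field; lra).
  assert (Hrx : (1 + x) * (1 + r) = 2) by (unfold r; field; lra).
  assert (Hsb := landen_argument_bounds r Hr); rewrite Hs in Hsb.
  assert (Hr2 := pow2_ge_0 r).
  assert (Fp : 0 < F (r ^ 2)) by (apply hypergeom_pos; lra).
  assert (Fsp : 0 < F (1 - x ^ 2)) by (apply hypergeom_pos; lra).
  assert (Bp : 0 < B) by now apply Beta_pos.
  assert (HP := PI_RGT_0).
  assert (Hden : 0 < (1 + x) * F (1 - x ^ 2)) by (apply Rmult_lt_0_compat; lra).
  assert (scale : forall u v, u <= v -> (1 + x) * u <= (1 + x) * v)
    by (intros; apply Rmult_le_compat_l; lra).
  assert (scale_lt : forall u v, u < v -> (1 + x) * u < (1 + x) * v)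
    by (intros; apply Rmult_lt_compat_l; lra).
  assert (E2 : 2 * F (r ^ 2) = (1 + x) * ((1 + r) * F (r ^ 2))) by (rewrite <- Hrx; ring).
  assert (half : (a, b) = (1 / 2, 1 / 2) -> F (1 - x ^ 2) = (1 + r) * F (r ^ 2)).
  { intros E; injection E as -> ->; rewrite <- Hs; now apply landen. }
  assert (EB : B / (2 * PI) * ((1 + x) * F (1 - x ^ 2)) =
               (1 + x) * (B * F (1 - x ^ 2)) / (2 * PI)) by (field; lra).
  assert (EF : F (r ^ 2) = (1 + x) * (PI * ((1 + r) * F (r ^ 2))) / (2 * PI)).
  { transitivity ((2 * F (r ^ 2)) / 2); [ field | rewrite E2; field; lra ]. }
  assert (H2P : 0 < / (2 * PI)) by (apply Rinv_0_lt_compat; lra).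
  split; [ | split; [ | split ] ].
  - intros H Hne; destruct (landen_strict_D1 a b r H Hne Hr) as [H1 H2].
    rewrite Hs in H1, H2; fold F B in H1, H2.
    apply scale_lt in H1, H2.
    split; [ apply -> Rcomplements.Rlt_div_r; lra | apply Rcomplements.Rlt_div_l; [ lra | ] ].
    rewrite EB, EF; now apply Rmult_lt_compat_r.
  - intros (_ & _ & H3).
    assert (H : D1 a b).
    { repeat split; [ assumption .. | ]; assert (Hsq := pow2_ge_0 (a - b)); nra. }
    assert (Hd := landen_defect_D1 a b r H Hr); rewrite Hs in Hd; fold F B R0 in Hd.
    rewrite E2; split; [ | apply scale; lra ].
    destruct (Classical_Prop.classic ((a, b) = (1 / 2, 1 / 2))) as [E | Hne].
    + rewrite half by exact E; lra.
    + destruct (landen_strict_D1 a b r H Hne Hr) as [H1 _].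
      rewrite Hs in H1; fold F in H1; apply scale; lra.
  - intros H Hne; destruct (landen_strict_D2 a b r H Hne Hr) as [H1 H2].
    rewrite Hs in H1, H2; fold F B in H1, H2.
    apply scale_lt in H1, H2.
    split; [ apply -> Rcomplements.Rlt_div_r; [ | lra ] | apply Rcomplements.Rlt_div_l; lra ].
    rewrite EB, EF; now apply Rmult_lt_compat_r.
  - intros H.
    assert (Hd := landen_defect_D2 a b r H Hr); rewrite Hs in Hd; fold F B R0 in Hd.
    rewrite E2; split.
    + destruct (Classical_Prop.classic ((a, b) = (1 / 2, 1 / 2))) as [E | Hne].
      * rewrite half by exact E; lra.
      * destruct (landen_strict_D2 a b r H Hne Hr) as [H1 _].
        rewrite Hs in H1; fold F in H1; apply scale_lt in H1; lra.
    + apply scale in Hd; unfold Rdiv in *; lra.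
Qed.
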